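(* Let $\beta$ be an ordered partition of $N$ and suppose $\zeta\in(\mathfrak t')^*_\beta$ is $\beta$-generic with $\zeta(c)\ne0$. Then, as $\bar{\mathcal H}$-modules, $\mathcal Y_\beta(\zeta)=\bigoplus_{x\in X^\beta}\bar{\mathcal H}\cdot\varphi_x{\bf 1}_\zeta$, and for each $x\in X^\beta$ the summand $\bar{\mathcal H}\cdot\varphi_x{\bf 1}_\zeta$ is irreducible and isomorphic to $\bar{\mathcal Y}_{\beta(x)}(\overline{x(\zeta)})$ (via ${\bf 1}_{\overline{x(\zeta)}}\mapsto\varphi_x{\bf 1}_\zeta$), where $\overline{x(\zeta)}\in\bar{\mathfrak t}^*$ is the restriction of $x(\zeta)$ to $\bar{\mathfrak t}$.
   Context: Fix an integer $N\ge2$. Let $\bar{\mathfrak t}=\bigoplus_{i=1}^N\mathbb C\epsilon_i^\vee$, $\mathfrak t'=\bar{\mathfrak t}\oplus\mathbb Cc$, and let $\epsilon_1,\dots,\epsilon_N\in\bar{\mathfrak t}^*$ be the dual basis; regard $\bar{\mathfrak t}^*\subset(\mathfrak t')^*=\bar{\mathfrak t}^*\oplus\mathbb Cc^*$ with $\epsilon_i(c)=0$, $c^*(c)=1$, $c^*(\bar{\mathfrak t})=0$. Put $(\epsilon_i,\epsilon_j)=\delta_{ij}$ and, for $\zeta\in(\mathfrak t')^*$ and $\bar\alpha=\sum_ia_i\epsilon_i$, $(\zeta,\bar\alpha)=\sum_ia_i\zeta(\epsilon_i^\vee)$. Let $\bar R=\{\alpha_{ij}=\epsilon_i-\epsilon_j:i\ne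 j\}$, $\bar R_+=\{\alpha_{ij}:i<j\}$, $\alpha_i=\alpha_{i,i+1}$ ($1\le i\le N-1$), $\bar\Pi=\{\alpha_1,\dots,\alpha_{N-1}\}$. With a formal symbol $\delta$, the affine roots are $R=\{\bar\alpha+k\delta:\bar\alpha\in\bar R,k\in\mathbb Z\}$, $R_+=\{\bar\alpha+k\delta:\bar\alpha\in\bar R_+,k\ge0\}\cup\{-\bar\alpha+k\delta:\bar\alpha\in\bar R_+,k>0\}$, $R_-=R\setminus R_+$, and $\alpha_0=\delta-\alpha_{1N}$; indices $0,\dots,N-1$ are read modulo $N$. For $\alpha=\bar\alpha+k\delta\in R$ and $\zeta\in(\mathfrak t')^*$ set $(\zeta,\alpha)=(\zeta,\bar\alpha)+k\zeta(c)$; the coroot is $\alpha^\vee=\bar\alpha^\vee+kc\in\mathfrak t'$, where $(\epsilon_i-\epsilon_j)^\vee=\epsilon_i^\vee-\epsilon_j^\vee$, and $\alpha(\xi):=\bar\alpha(\xi)$ for $\xi\in\mathfrak t'$. Let $\bar P=\bigoplus_i\mathbb Z\epsilon_i$, $\bar P_-=\{\eta\in\bar P:(\eta,\alpha)\le0\ \forall\alpha\in\bar R_+\}$, $\bar W=\mathfrak S_N$ acting on indices ($w(\epsilon_i)=\epsilon_{w(i)}$, $w(\epsilon_i^\vee)=\epsilon^\vee_{w(i)}$, $w(c)=c$, $w(c^* )=c^*$), and $W=\bar W\ltimes\bar P$ with elements $wt_\eta$ and $wt_\eta w^{-1}=t_{w(\eta)}$. $W$ acts on $R$ by $w(\bar\alpha+k\delta)=w(\bar\alpha)+k\delta$,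 $t_\eta(\bar\alpha+k\delta)=\bar\alpha+(k-(\eta,\bar\alpha))\delta$; on $\mathfrak t'$ by $t_\eta(\xi)=\xi-\eta(\xi)c$; and on $(\mathfrak t')^*$ by the affine action $t_\eta(\zeta)=\zeta+\zeta(c)\eta$. For $\alpha=\bar\alpha+k\delta\in R$ let $s_\alpha=t_{-k\bar\alpha}s_{\bar\alpha}$, $s_i=s_{\alpha_i}$, $\pi=t_{\epsilon_1}s_1\cdots s_{N-1}$; $W$ is generated by $s_0,\dots,s_{N-1},\pi^{\pm1}$. $S(w)=R_+\cap w^{-1}(R_-)$, $l(w)=\#S(w)$, reduced expressions $w=\pi^ks_{j_1}\cdots s_{j_l}$ have $l=l(w)$. The degenerate double affine Hecke algebra $\mathcal H$ is the unital associative $\mathbb C$-algebra equal to $\mathbb C[W]\otimes S[\mathfrak t']$ as a vector space (via multiplication), in which $\mathbb C[W]$ and $S[\mathfrak t']$ are subalgebras and $s_i\xi-s_i(\xi)s_i=-\alpha_i(\xi)$ ($0\le i\le N-1$, $\xi\in\mathfrak t'$), $\pi\xi=\pi(\xi)\pi$. $\bar{\mathcal H}$ is the subalgebra generated by $\bar W$ and $\bar{\mathfrak t}$. Intertwiners: $\varphi_i=1+s_i\alpha_i^\vee$, $\varphi_\pi=\pi$, $\varphi_w=\varphi_\pi^k\varphi_{j_1}\cdots\varphi_{j_l}$ for a reduced expression $w=\pi^ks_{j_1}\cdots s_{j_l}$. An ordered partition $\gamma$ of $N$ gives blocks of consecutive indices of sizes $\gamma_1,\dots,\gamma_r$; $\bar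 R_\gamma=\{\alpha_{ij}:i,j\text{ in the same block}\}$, $\bar R_{\gamma,+}=\bar R_\gamma\cap\bar R_+$, $\bar\Pi_\gamma=\bar\Pi\cap\bar R_\gamma$, $\bar W_\gamma=\langle s_\alpha:\alpha\in\bar\Pi_\gamma\rangle$; $\mathcal H_\gamma$ (resp. $\bar{\mathcal H}_\gamma$) is the subalgebra generated by $S[\mathfrak t']$ (resp. $S[\bar{\mathfrak t}]$) and $\bar W_\gamma$. $(\mathfrak t')^*_\gamma=\{\zeta\in(\mathfrak t')^*:(\zeta,\alpha)=-1\ \forall\alpha\in\bar\Pi_\gamma\}$, and $\bar{\mathfrak t}^*_\gamma$ analogously in $\bar{\mathfrak t}^*$. For such $\zeta$, $\mathbb C1_\zeta$ is the one-dimensional module with $w1_\zeta=1_\zeta$ ($w\in\bar W_\gamma$), $\xi1_\zeta=\zeta(\xi)1_\zeta$; $\mathcal Y_\gamma(\zeta)=\mathcal H\otimes_{\mathcal H_\gamma}\mathbb C1_\zeta$, $\bar{\mathcal Y}_\gamma(\zeta)=\bar{\mathcal H}\otimes_{\bar{\mathcal H}_\gamma}\mathbb C1_\zeta$, with cyclic vector ${\bf 1}_\zeta=1\otimes1_\zeta$. $W^\gamma=\{w\in W:l(wu)\ge l(w)\ \forall u\in\bar W_\gamma\}$, $\bar W^\gamma=W^\gamma\cap\bar W$. A weight $\zeta\in(\mathfrak t')^*_\gamma$ is $\gamma$-generic if $(\zeta,\alpha)\notin\{1,0,-1\}$ for all $\alpha\in R_+\setminus\bar R_{\gamma,+}$.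 For $w\in W$, $\beta(w)$ is the ordered partition of $N$ with $\bar\Pi_{\beta(w)}=\bar\Pi\cap w(\bar R_{\beta,+})$. For $w\in\bar W^\beta$, $\eta_w\in\bar P_-$ is defined by $(\eta_w,\epsilon_1)=0$ and $(\eta_w,\alpha_i)=-1$ if $\alpha_i\in w(\bar R_+\setminus\bar R_{\beta,+})$, $0$ otherwise; $\bar P_-(w)=\{\eta+\eta_w:\eta\in\bar P_-\}$; $X^\beta=\{t_\eta w:w\in\bar W^\beta,\eta\in\bar P_-(w)\}$. *)

(* Defs.v *)
(* Degenerate DAHA of type GL_N, encoded via modules
   (operations on a vector space satisfying the defining relations). *)
From HB Require Import structures.
From mathcomp Require Import all_boot all_order all_algebra all_fingroup.
Set Implicit Arguments. Unset Strict Implicit. Unset Printing Implicit Defensive.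
Import GRing.Theory Num.Theory.
Local Open Scope ring_scope.

(* Indices: 'I_N, 0-based.  Paper index p (1..N) is position p-1.       *)
(* Simple roots alpha_i, i : 'I_N, i = 0 .. N-1 (paper's indices).      *)
(*   for i <> 0 : alpha_i = eps_{i-1} - eps_i (0-based positions)       *)
(*   alpha_0    = delta - (eps_0 - eps_{N-1})                           *)

Lemma prev_lt {N} (i : 'I_N) : (i.-1 < N)%N.
Proof. exact: leq_ltn_trans (leq_pred i) (ltn_ord i). Qed.
Definition prevo {N} (i : 'I_N) : 'I_N := Ordinal (prev_lt i).

Lemma last_lt {N} (i : 'I_N) : (N.-1 < N)%N.
Proof. by case: N i => [[m]|n _] //=; rewrite ltnSn. Qed.
Definition lasto {N} (i : 'I_N) : 'I_N := Ordinal (last_lt i).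

Lemma first_lt {N} (i : 'I_N) : (0 < N)%N.
Proof. exact: leq_ltn_trans (leq0n i) (ltn_ord i). Qed.
Definition firsto {N} (i : 'I_N) : 'I_N := Ordinal (first_lt i).

(* Extended affine Weyl group W = S_N |x P.                             *)
(* The pair (u, eta) stands for t_eta u.                                *)
(* Note: in mathcomp (s * t)%g x = t (s x), so u o v = (v * u)%g.       *)
Definition W (N : nat) := ('S_N * {ffun 'I_N -> int})%type.

Definition wone {N} : W N := (1%g, [ffun => 0]).
Definition wmul {N} (x y : W N) : W N :=
  ((y.1 * x.1)%g, [ffun j => x.2 j + y.2 ((x.1)^-1%g j)]).
Definition winv {N} (x : W N) : W N :=
  ((x.1)^-1%g, [ffun j => - x.2 (x.1 j)]).
Definition wpowz {N} (x : W N) (k : int) : W N :=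
  match k with
  | Posz n => iter n (wmul x) wone
  | Negz n => iter n.+1 (wmul (winv x)) wone
  end.

(* generators s_0, ..., s_{N-1};  s_0 = s_{alpha_0} = t_{eps_1 - eps_N} s_{alpha_{1N}} *)
Definition sgen {N} (i : 'I_N) : W N :=
  if val i == 0%N then
    (tperm (firsto i) (lasto i),
     [ffun j => (nat_of_bool (val j == 0%N))%:Z - (nat_of_bool (val j == N.-1))%:Z])
  else (tperm (prevo i) i, [ffun => 0]).

(* pi = t_{eps_1} s_1 ... s_{N-1}; s_1...s_{N-1} is the cyclic shift j -> j+1 mod N *)
Definition cshift {N} : 'S_N := perm (@ordS_inj N).
Definition piW {N} : W N := (cshift, [ffun j => (nat_of_bool (val j == 0%N))%:Z]).

(* Affine roots  eps_a - eps_b + k delta  (a <> b) as triples (a,b,k).  *)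
Definition wroot {N} (w : W N) (a b : 'I_N) (k : int) : 'I_N * 'I_N * int :=
  (w.1 a, w.1 b, k - (w.2 (w.1 a) - w.2 (w.1 b))).

Definition rootpos {N} (a b : 'I_N) (k : int) : bool :=
  ((val a < val b)%N && (0 <= k)) || ((val b < val a)%N && (0 < k)).
Definition rootneg {N} (a b : 'I_N) (k : int) : bool := (a != b) && ~~ rootpos a b k.

Definition inS {N} (w : W N) (a b : 'I_N) (k : int) : bool :=
  [&& a != b, rootpos a b k & (let r := wroot w a b k in rootneg r.1.1 r.1.2 r.2)].

(* every element of S(w) has 0 <= k <= lbound w (since k <= eta_{ua} - eta_{ub}),
   so l(w) = #S(w) is the following finite count. *)
Definition lbound {N} (w : W N) : nat := (\sum_(j < N) `|w.2 j|)%N.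
Definition wlength {N} (w : W N) : nat :=
  (\sum_(a < N) \sum_(b < N) \sum_(k < (lbound w).+1) nat_of_bool (inS w a b k%:Z))%N.

(* A subset of \bar\Pi is encoded as a selector sel : 'I_N -> bool       *)
(* (alpha_i \in \bar\Pi_gamma iff i <> 0 and sel i).                     *)
Definition is_composition (N : nat) (g : seq nat) : Prop :=
  all (fun p => (0 < p)%N) g /\ sumn g = N.

(* block number of the 0-based position p *)
Definition blk (g : seq nat) (p : nat) : nat :=
  (\sum_(k < size g) nat_of_bool (\sum_(l < k.+1) nth 0%N g l <= p))%N.

Definition selP {N} (g : seq nat) : 'I_N -> bool :=
  fun i => (val i != 0%N) && (blk g i.-1 == blk g i).

Definition sameblk {N} (sel : 'I_N -> bool) (a b : 'I_N) : bool :=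
  [forall i : 'I_N, ((minn a b < i) && (i <= maxn a b))%N ==> sel i].

Definition inRgp {N} (sel : 'I_N -> bool) (a b : 'I_N) (k : int) : bool :=
  [&& k == 0, (val a < val b)%N & sameblk sel a b].

Definition in_Wbar_gamma {N} (sel : 'I_N -> bool) (w : W N) : Prop :=
  exists js : seq 'I_N, all (fun i => (val i != 0%N) && sel i) js /\
                        w = foldr wmul wone (map sgen js).

Definition in_Wsup {N} (sel : 'I_N -> bool) (w : W N) : Prop :=
  forall u, in_Wbar_gamma sel u -> (wlength w <= wlength (wmul w u))%N.
Definition in_Wbarsup {N} (sel : 'I_N -> bool) (w : W N) : Prop :=
  in_Wsup sel w /\ w.2 = [ffun => 0].

Definition is_dom {N} (eta : {ffun 'I_N -> int}) : Prop :=
  forall a b : 'I_N, (val a < val b)%N -> eta a <= eta b.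

Definition is_eta_w {N} (sel : 'I_N -> bool) (u : 'S_N) (eta : {ffun 'I_N -> int}) : Prop :=
  (forall i : 'I_N, val i = 0%N -> eta i = 0) /\
  (forall i : 'I_N, val i != 0%N ->
     eta (prevo i) - eta i =
       if [exists a : 'I_N, exists b : 'I_N,
             [&& (val a < val b)%N, ~~ sameblk sel a b, u a == prevo i & u b == i]]
       then -1 else 0).

Definition in_X {N} (sel : 'I_N -> bool) (x : W N) : Prop :=
  exists (u : 'S_N) (eta0 etaw : {ffun 'I_N -> int}),
    [/\ in_Wbarsup sel (u, [ffun => 0]), is_dom eta0, is_eta_w sel u etaw &
        x = (u, [ffun j => eta0 j + etaw j])].

(* beta(w): \bar\Pi_{beta(w)} = \bar\Pi \cap w(\bar R_{beta,+}) *)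
Definition selB {N} (sel : 'I_N -> bool) (w : W N) : 'I_N -> bool :=
  fun i => (val i != 0%N) &&
    [exists a : 'I_N, exists b : 'I_N,
       inRgp sel a b 0 && (wroot w a b 0 == (prevo i, i, 0))].

(* t' = \bar t + C c and its dual, over a field F.                      *)
(* xi = (x, xc) means sum_i x_i eps_i^vee + xc c;                       *)
(* zeta = (z, zc) means sum_i z_i eps_i + zc c^*.                       *)
Definition tvec (F : numClosedFieldType) N := ({ffun 'I_N -> F} * F)%type.
Definition tdual (F : numClosedFieldType) N := ({ffun 'I_N -> F} * F)%type.

Definition wact_t {F : numClosedFieldType} {N} (w : W N) (xi : tvec F N) : tvec F N :=
  let ux := [ffun j => xi.1 ((w.1)^-1%g j)] in
  (ux, xi.2 - \sum_(j < N) (w.2 j)%:~R * ux j).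

Definition wact_dual {F : numClosedFieldType} {N} (w : W N) (z : tdual F N) : tdual F N :=
  ([ffun j => z.1 ((w.1)^-1%g j) + z.2 * (w.2 j)%:~R], z.2).

Definition pair_root {F : numClosedFieldType} {N} (z : tdual F N) (a b : 'I_N) (k : int) : F :=
  z.1 a - z.1 b + k%:~R * z.2.

Definition alpha_of {F : numClosedFieldType} {N} (i : 'I_N) (xi : tvec F N) : F :=
  if val i == 0%N then xi.1 (lasto i) - xi.1 (firsto i) else xi.1 (prevo i) - xi.1 i.

Definition coroot {F : numClosedFieldType} {N} (i : 'I_N) : tvec F N :=
  if val i == 0%N then
    ([ffun j => (j == lasto i)%:R - (j == firsto i)%:R], 1)
  else ([ffun j => (j == prevo i)%:R - (j == i)%:R], 0).

Definition in_tdual_gamma {F : numClosedFieldType} {N} (sel : 'I_N -> bool) (z : tdual F N) : Prop :=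
  forall i : 'I_N, val i != 0%N -> sel i -> z.1 (prevo i) - z.1 i = -1.

Definition generic {F : numClosedFieldType} {N} (sel : 'I_N -> bool) (z : tdual F N) : Prop :=
  forall (a b : 'I_N) (k : int), a != b -> rootpos a b k -> ~~ inRgp sel a b k ->
    ~ (pair_root z a b k = 1 \/ pair_root z a b k = 0 \/ pair_root z a b k = -1).

(* Modules.  An H-module is a vector space with operators for W, for   *)
(* the basis eps_i^vee of \bar t and for c, satisfying the defining     *)
(* relations of H; likewise for \bar H (generated by \bar W, \bar t).    *)
Record Hops (F : numClosedFieldType) (N : nat) (V : lmodType F) := HOps {
  hW : W N -> V -> V; hX : 'I_N -> V -> V; hC : V -> V }.
Record Bops (F : numClosedFieldType) (N : nat) (V : lmodType F) := BOps {
  bW : 'S_N -> V -> V; bX : 'I_N -> V -> V }.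

Arguments Hops : clear implicits.
Arguments Bops : clear implicits.

Definition lin {F : numClosedFieldType} {V U : lmodType F} (f : V -> U) : Prop :=
  forall (a : F) (u v : V), f (a *: u + v) = a *: f u + f v.

Definition actT {F : numClosedFieldType} {N : nat} {V : lmodType F} (M : Hops F N V) (xi : tvec F N) (v : V) : V :=
  \sum_(i < N) xi.1 i *: hX M i v + xi.2 *: hC M v.
Definition actTb {F : numClosedFieldType} {N : nat} {V : lmodType F} (B : Bops F N V) (xi : {ffun 'I_N -> F}) (v : V) : V :=
  \sum_(i < N) xi i *: bX B i v.

Definition is_Hmod {F : numClosedFieldType} {N : nat} {V : lmodType F} (M : Hops F N V) : Prop :=
  [/\ (forall x, lin (hW M x)) /\ (forall i, lin (hX M i)) /\ lin (hC M),
      (forall v, hW M wone v = v) /\ (forall x y v, hW M (wmul x y) v = hW M x (hW M y v)),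
      (forall i j v, hX M i (hX M j v) = hX M j (hX M i v)) /\
      (forall i v, hX M i (hC M v) = hC M (hX M i v)),
      (forall i xi v, hW M (sgen i) (actT M xi v) - actT M (wact_t (sgen i) xi) (hW M (sgen i) v)
                      = - alpha_of i xi *: v)
    & (forall xi v, hW M piW (actT M xi v) = actT M (wact_t piW xi) (hW M piW v))].

Definition is_Bmod {F : numClosedFieldType} {N : nat} {V : lmodType F} (B : Bops F N V) : Prop :=
  [/\ (forall u, lin (bW B u)) /\ (forall i, lin (bX B i)),
      (forall v, bW B 1%g v = v) /\ (forall u u' v, bW B (u' * u)%g v = bW B u (bW B u' v)),
      (forall i j v, bX B i (bX B j v) = bX B j (bX B i v))
    & (forall (i : 'I_N) xi v, val i != 0%N ->
         bW B (tperm (prevo i) i) (actTb B xi v)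
         - actTb B [ffun j => xi ((tperm (prevo i) i)^-1%g j)] (bW B (tperm (prevo i) i) v)
         = - (xi (prevo i) - xi i) *: v)].

Definition resB {F : numClosedFieldType} {N : nat} {V : lmodType F} (M : Hops F N V) : Bops F N V :=
  BOps (fun u => hW M (u, [ffun => 0])) (hX M).

Definition equivH {F : numClosedFieldType} {N : nat} {V U : lmodType F} (M : Hops F N V) (MU : Hops F N U) (f : V -> U) : Prop :=
  [/\ forall x v, f (hW M x v) = hW MU x (f v),
      forall i v, f (hX M i v) = hX MU i (f v)
    & forall v, f (hC M v) = hC MU (f v)].
Definition equivB {F : numClosedFieldType} {N : nat} {V U : lmodType F} (B : Bops F N V) (BU : Bops F N U) (f : V -> U) : Prop :=
  (forall u v, f (bW B u v) = bW BU u (f v)) /\ (forall i v, f (bX B i v) = bX BU i (f v)).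

Inductive Hgen {F : numClosedFieldType} {N : nat} {V : lmodType F} (M : Hops F N V) (v0 : V) : V -> Prop :=
| Hg_base : Hgen M v0 v0
| Hg_zero : Hgen M v0 0
| Hg_add u w : Hgen M v0 u -> Hgen M v0 w -> Hgen M v0 (u + w)
| Hg_scale a u : Hgen M v0 u -> Hgen M v0 (a *: u)
| Hg_W x u : Hgen M v0 u -> Hgen M v0 (hW M x u)
| Hg_X i u : Hgen M v0 u -> Hgen M v0 (hX M i u)
| Hg_C u : Hgen M v0 u -> Hgen M v0 (hC M u).

Inductive Bgen {F : numClosedFieldType} {N : nat} {V : lmodType F} (B : Bops F N V) (v0 : V) : V -> Prop :=
| Bg_base : Bgen B v0 v0
| Bg_zero : Bgen B v0 0
| Bg_add u w : Bgen B v0 u -> Bgen B v0 w -> Bgen B v0 (u + w)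
| Bg_scale a u : Bgen B v0 u -> Bgen B v0 (a *: u)
| Bg_W s u : Bgen B v0 u -> Bgen B v0 (bW B s u)
| Bg_X i u : Bgen B v0 u -> Bgen B v0 (bX B i u).

Definition is_Bsub {F : numClosedFieldType} {N : nat} {V : lmodType F} (B : Bops F N V) (P : V -> Prop) : Prop :=
  [/\ P 0, (forall u w, P u -> P w -> P (u + w)), (forall a u, P u -> P (a *: u)),
      (forall s u, P u -> P (bW B s u)) & (forall i u, P u -> P (bX B i u))].

Definition Birreducible {F : numClosedFieldType} {N : nat} {V : lmodType F} (B : Bops F N V) (P : V -> Prop) : Prop :=
  (exists v, P v /\ v <> 0) /\
  forall Q : V -> Prop, is_Bsub B Q -> (forall v, Q v -> P v) ->
    (forall v, Q v -> v = 0) \/ (forall v, P v -> Q v).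

Definition relH {F : numClosedFieldType} {N : nat} {V : lmodType F} (sel : 'I_N -> bool) (z : tdual F N) (M : Hops F N V) (v : V) : Prop :=
  [/\ forall w, in_Wbar_gamma sel w -> hW M w v = v,
      forall i, hX M i v = z.1 i *: v
    & hC M v = z.2 *: v].
Definition relB {F : numClosedFieldType} {N : nat} {V : lmodType F} (sel : 'I_N -> bool) (z : {ffun 'I_N -> F}) (B : Bops F N V) (v : V) : Prop :=
  (forall u : 'S_N, in_Wbar_gamma sel (u, [ffun => 0]) -> bW B u v = v) /\
  (forall i, bX B i v = z i *: v).

(* (V, M, one) is (a model of) the induced module
   Y_gamma(zeta) = H \otimes_{H_gamma} C 1_zeta with 1_zeta = one,
   characterized by its universal property. *)
Definition is_induced_H {F : numClosedFieldType} {N : nat} {V : lmodType F} (sel : 'I_N -> bool) (z : tdual F N)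
  (M : Hops F N V) (one : V) : Prop :=
  [/\ is_Hmod M, relH sel z M one, (forall v, Hgen M one v)
    & forall (U : lmodType F) (MU : Hops F N U) (u : U), is_Hmod MU -> relH sel z MU u ->
        exists f : V -> U, [/\ lin f, equivH M MU f & f one = u]].

(* (V, B, one) is (a model of) \bar Y_gamma(z) = \bar H \otimes_{\bar H_gamma} C 1_z *)
Definition is_induced_B {F : numClosedFieldType} {N : nat} {V : lmodType F} (sel : 'I_N -> bool) (z : {ffun 'I_N -> F})
  (B : Bops F N V) (one : V) : Prop :=
  [/\ is_Bmod B, relB sel z B one, (forall v, Bgen B one v)
    & forall (U : lmodType F) (BU : Bops F N U) (u : U), is_Bmod BU -> relB sel z BU u ->
        exists f : V -> U, [/\ lin f, equivB B BU f & f one = u]].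

Definition phi_gen {F : numClosedFieldType} {N : nat} {V : lmodType F} (M : Hops F N V) (i : 'I_N) (v : V) : V :=
  v + hW M (sgen i) (actT M (coroot i) v).

Definition is_red {N} (w : W N) (r : int * seq 'I_N) : Prop :=
  w = wmul (wpowz piW r.1) (foldr wmul wone (map sgen r.2)) /\ size r.2 = wlength w.

Definition phi_red {F : numClosedFieldType} {N : nat} {V : lmodType F} (M : Hops F N V) (r : int * seq 'I_N) (v : V) : V :=
  hW M (wpowz piW r.1) (foldr (phi_gen M) v r.2).

(* Main.v *)
Require Import Defs.
From HB Require Import structures.
From mathcomp Require Import all_boot all_order all_algebra all_fingroup.
From mathcomp Require Import zify ring.
From mathcomp Require Import finmap.
From mathcomp.multinomials Require Import monalg.
From Stdlib Require Import Classical.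
Set Implicit Arguments. Unset Strict Implicit. Unset Printing Implicit Defensive.
Import Order.TTheory GRing.Theory Num.Theory.
Local Open Scope ring_scope.

(** Because [zeta] is generic, its stabilizer in W is trivial, and [(zeta, alpha)] is [1] or [-1]
    only for roots alpha of the blocks. On a vector of weight mu the intertwiner phi_i squares to
    [1 - (mu, alpha_i)^2], so it can be inverted unless [(mu, alpha_i)] is [1] or [-1].

    The vectors w.1 are triangular for the length under the action of t', and w.1 only depends on
    the coset of w, so the only weights of Y_beta(zeta) are the w(zeta) with w minimal in its coset.
    Such a w is reached from a power of pi by left multiplications whose intertwiners are all
    invertible. Hence each weight space is a line, a nonzero submodule contains 1, and phi_i kills
    the vector of weight w(zeta) as soon as s_i w is not minimal; the independence of phi_w from
    the reduced word is never needed.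

    The same argument applies to \bar H. Give each root its height outside the blocks. A minimal w
    can be moved inside its \bar W-orbit by invertible finite intertwiners until no positive finite
    root has a preimage of positive height. The elements where this stops form X^beta and there is
    exactly one of them in each orbit, so Y_beta(zeta) is the sum of the \bar H.phi_x 1, which are
    irreducible with pairwise disjoint sets of weights.

    All of this collapses if 1 = 0; that it does not is shown on the explicit module C[W], with t'
    acting by Dunkl operators, where the sum of the elements of \bar W_beta satisfies the defining
    relations of 1_zeta. *)

(** * The extended affine Weyl group *)

Section Group.
Variable N : nat.
Implicit Types (x y w : W N) (i j a b : 'I_N).

Lemma W_ext x y : x.1 = y.1 -> (forall j, x.2 j = y.2 j) -> x = y.
Proof. by case: x y => [u e] [v f] /= -> h; congr pair; apply/ffunP. Qed.

Lemma wmulA x y w : wmul x (wmul y w) = wmul (wmul x y) w.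
Proof. by apply: W_ext => [|j]; rewrite /= ?mulgA // !ffunE /= addrA invMg permM. Qed.

Lemma wmul1w x : wmul wone x = x.
Proof. by apply: W_ext => [|j]; rewrite /= ?mulg1 // !ffunE add0r invg1 perm1. Qed.

Lemma wmulw1 x : wmul x wone = x.
Proof. by apply: W_ext => [|j]; rewrite /= ?mul1g // !ffunE addr0. Qed.

Lemma wmulVw x : wmul (winv x) x = wone.
Proof. by apply: W_ext => [|j]; rewrite /= ?mulgV // !ffunE /= invgK addNr. Qed.

Lemma wmulwV x : wmul x (winv x) = wone.
Proof. by apply: W_ext => [|j]; rewrite /= ?mulVg // !ffunE /= permKV subrr. Qed.

Lemma wmulKw x y : wmul (winv x) (wmul x y) = y.
Proof. by rewrite wmulA wmulVw wmul1w. Qed.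

Lemma wmulVKw x y : wmul x (wmul (winv x) y) = y.
Proof. by rewrite wmulA wmulwV wmul1w. Qed.

Lemma wmul_eq1 x y : wmul (winv x) y = wone -> x = y.
Proof. by move=> /(congr1 (wmul x)); rewrite wmulVKw wmulw1. Qed.

Lemma winvK : involutive (@winv N).
Proof. by move=> x; rewrite -[LHS]wmulw1 -(wmulVw x) wmulA wmulVw wmul1w. Qed.

Lemma winvM x y : winv (wmul x y) = wmul (winv y) (winv x).
Proof. by rewrite -[RHS](wmulKw (wmul x y)) -(wmulA x y) wmulVKw wmulwV wmulw1. Qed.

Lemma winv1 : winv wone = wone :> W N.
Proof. by rewrite -[LHS]wmul1w wmulwV. Qed.

Definition degree w : int := \sum_j w.2 j.

Lemma degreeM x y : degree (wmul x y) = degree x + degree y.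
Proof.
rewrite /degree /=; under eq_bigr do rewrite ffunE.
rewrite big_split /=; congr +%R; rewrite (reindex_inj (@perm_inj _ x.1)) /=.
by under eq_bigr do rewrite permK.
Qed.

Lemma degree1 : degree wone = 0.
Proof. by rewrite /degree big1 // => j _; rewrite ffunE. Qed.

Lemma degreeV x : degree (winv x) = - degree x.
Proof. by apply/eqP; rewrite -addr_eq0 -degreeM wmulVw degree1. Qed.

Definition affine_root := ('I_N * 'I_N * int)%type.
Implicit Types r : affine_root.

Definition wact_root w r : affine_root := wroot w r.1.1 r.1.2 r.2.
Definition pos_root r : bool := rootpos r.1.1 r.1.2 r.2.
Definition is_root r : bool := r.1.1 != r.1.2.
Definition opp_root r : affine_root := (r.1.2, r.1.1, - r.2).
Definition simple_root i : affine_root :=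
  if val i == 0%N then (lasto i, firsto i, 1) else (prevo i, i, 0).

Lemma wact_rootM x y r : wact_root (wmul x y) r = wact_root x (wact_root y r).
Proof.
case: r => [[a b] k]; rewrite /wact_root /wroot /= !ffunE /= !permM !permK.
by congr (_, _, _); ring.
Qed.

Lemma wact_root1 r : wact_root wone r = r.
Proof.
case: r => [[a b] k]; rewrite /wact_root /wroot /= !ffunE /= !perm1.
by congr (_, _, _); ring.
Qed.

Lemma wact_rootK w : cancel (wact_root w) (wact_root (winv w)).
Proof. by move=> r; rewrite -wact_rootM wmulVw wact_root1. Qed.

Lemma wact_rootVK w : cancel (wact_root (winv w)) (wact_root w).
Proof. by move=> r; rewrite -wact_rootM wmulwV wact_root1. Qed.

Lemma wact_root_inj w : injective (wact_root w).
Proof. exact: can_inj (wact_rootK w). Qed.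

Lemma is_root_wact w r : is_root (wact_root w r) = is_root r.
Proof. by rewrite /is_root /= (inj_eq perm_inj). Qed.

Lemma wact_rootVE w a b k :
  wact_root (winv w) (a, b, k) = ((w.1^-1)%g a, (w.1^-1)%g b, k + w.2 a - w.2 b).
Proof.
by rewrite /wact_root /wroot /= !ffunE !permKV; congr (_, _, _); ring.
Qed.

Lemma is_root_opp r : is_root (opp_root r) = is_root r.
Proof. by rewrite /is_root eq_sym. Qed.

Lemma opp_rootK : involutive opp_root.
Proof. by case=> [[a b] k]; rewrite /opp_root /= opprK. Qed.

Lemma wact_root_opp w r : wact_root w (opp_root r) = opp_root (wact_root w r).
Proof. by rewrite /wact_root /wroot /opp_root /=; congr (_, _, _); ring. Qed.

Lemma pos_root_opp r : is_root r -> pos_root (opp_root r) = ~~ pos_root r.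
Proof.
case: r => [[a b] k]; rewrite /is_root /pos_root /rootpos /= -val_eqE /=; lia.
Qed.

End Group.

Section OrdinalInduction.
Variable N : nat.
Implicit Types (i j a b : 'I_N).

Lemma ord_prev_ind (P : 'I_N -> Prop) :
  (forall i, val i = 0%N -> P i) -> (forall i, val i != 0%N -> P (prevo i) -> P i) ->
  forall j, P j.
Proof.
move=> P0 PS [n hn]; elim: n hn => [|n IH] hn; first exact: P0.
have hn' : (n < N)%N by apply: ltnW.
by apply: PS => //; have -> : prevo (Ordinal hn) = Ordinal hn' by apply: val_inj.
Qed.

Lemma sameblk_homo (sel : 'I_N -> bool) (T : Type) (R : T -> T -> Prop) (f : 'I_N -> T) :
  (forall y x z, R x y -> R y z -> R x z) ->
  (forall i, val i != 0%N -> sel i -> R (f (prevo i)) (f i)) ->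
  forall a b, (a < b)%N -> sameblk sel a b -> R (f a) (f b).
Proof.
move=> Rtr Radj a; apply: ord_prev_ind => [b ->//|b b0 IH ab /forallP sab].
have sb : sel b by have /implyP := sab b; apply; move: ab; lia.
have [ap|pa] := ltnP a (prevo b); last first.
  have -> : a = prevo b by apply: val_inj; move: pa ab b0 => /=; lia.
  exact: Radj.
apply: Rtr (Radj b b0 sb); apply: IH => //.
apply/forallP => i; apply/implyP => hi; have /implyP := sab i; apply.
by move: ap hi b0 => /=; lia.
Qed.

Lemma adjacent_le_homo (f : 'I_N -> int) : (forall i, val i != 0%N -> f (prevo i) <= f i) ->
  forall a b, (a <= b)%N -> f a <= f b.
Proof.
move=> adj a b; rewrite leq_eqVlt => /orP[/eqP/val_inj-> //|ab].
apply: (@sameblk_homo xpredT _ (fun m n => m <= n)) ab _ => [y x z|i i0 _|].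
- exact: le_trans.
- exact: adj.
- by apply/forallP => i; apply/implyP.
Qed.

(* Once the identity is subtracted the values increase weakly, and they stay in an interval
   of length less than 1. *)
Lemma increasing_short_span (f : 'I_N -> int) :
  (forall i, val i != 0%N -> f (prevo i) < f i) ->
  (forall i, f (lasto i) < f (firsto i) + N%:Z) -> forall j, f j = f (firsto j) + j%:Z.
Proof.
move=> inc short j; have h := @adjacent_le_homo (fun i => f i - i%:Z).
have {}h : forall a b : 'I_N, (a <= b)%N -> f a - a%:Z <= f b - b%:Z.
  by apply: h => i i0; have := inc i i0; move: i0 => /=; lia.
have := h (firsto j) j (leq0n j); have := h j (lasto j); have := short j.
by have := ltn_ord j; rewrite /=; lia.
Qed.

Lemma tperm_val a b j : let t := val (tperm a b j) in
  [|| (val j == val a) && (t == val b), (val j == val b) && (t == val a) |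
     [&& val j != val a, val j != val b & t == val j]].
Proof.
case: tpermP => [->|->|/eqP ja /eqP jb] /=; rewrite ?eqxx ?orbT //.
by rewrite -!val_eqE in ja jb; rewrite ja jb !orbT.
Qed.

End OrdinalInduction.

Section Windows.
Variable N : nat.
Hypothesis N2 : (2 <= N)%N.
Implicit Types (x y w : W N) (i j a b : 'I_N) (r : affine_root N).

Lemma mulz_signP (k : int) : [\/ k < 0 /\ N%:Z * k <= - N%:Z, k = 0 | 0 < k /\ N%:Z <= N%:Z * k].
Proof.
have N0 : 0 <= N%:Z by [].
case: (ltrgtP k 0) => [k0|k0|->]; last by constructor 2.
- by constructor 1; split=> //; rewrite -mulrN1 ler_wpM2l //; lia.
- by constructor 3; split=> //; rewrite -[X in X <= _]mulr1 ler_wpM2l //; lia.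
Qed.

Lemma pos_rootE r : is_root r -> pos_root r = (r.1.1%:Z < r.1.2%:Z + N%:Z * r.2).
Proof.
case: r => [[a b] k]; rewrite /is_root /pos_root /rootpos -val_eqE /= => ab.
have := ltn_ord a; have := ltn_ord b; move: ab.
by case: (mulz_signP k) => [[]|->|[]]; lia.
Qed.

(* [w], viewed as a permutation of the integers commuting with the translation by N. *)
Definition window w j : int := (w.1 j)%:Z + N%:Z * w.2 (w.1 j).

Lemma pos_root_wactE w r : is_root r ->
  pos_root (wact_root w r) = (window w r.1.1 < window w r.1.2 + N%:Z * r.2).
Proof.
move=> ir; rewrite pos_rootE ?is_root_wact // /window /= mulrBr mulrBr.
by apply/idP/idP; lia.
Qed.

Lemma window_mul_shift x y (k : int) : (forall j, window x j = k + j%:Z) ->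
  forall j, window (wmul x y) j = k + window y j.
Proof.
move=> xk j; have := xk (y.1 j); rewrite /window /= ffunE permM permK => xj.
by rewrite mulrDr !addrA xj.
Qed.

Lemma window1 j : window wone j = j.
Proof. by rewrite /window ffunE perm1 mulr0 addr0. Qed.

Lemma window_inj x : (forall j, window x j = j%:Z) -> x = wone.
Proof.
move=> h.
have x2 j : x.2 (x.1 j) = 0.
  have := h j; rewrite /window; have := ltn_ord j; have := ltn_ord (x.1 j).
  by case: (mulz_signP (x.2 (x.1 j))) => [[]|->|[]]; lia.
have x1 : x.1 = 1%g.
  by apply/permP => j; have := h j; rewrite /window x2 mulr0 addr0 perm1 => -[/val_inj].
apply: W_ext => [|j]; rewrite ?x1 // ffunE; by have := x2 j; rewrite x1 perm1.
Qed.

Lemma cshift_val a : val (cshift a) = if val a == N.-1 then 0%N else (val a).+1.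
Proof.
rewrite /cshift permE /= /ordS /=; case: ifP => h; first by rewrite (eqP h) prednK ?modnn //; lia.
by rewrite modn_small //; have := ltn_ord a; move: h => /=; lia.
Qed.

Lemma window_pi j : window piW j = 1 + j%:Z.
Proof.
rewrite /window /= ffunE cshift_val; have := ltn_ord j.
by case: (val j =P N.-1) => [->|] /=; rewrite ?mulr1 ?mulr0; lia.
Qed.

Lemma window_pow k j : window (wpowz piW k) j = k + j%:Z.
Proof.
have piV i : window (winv piW) i = -1 + i%:Z.
  have := window_mul_shift (winv piW) window_pi i; rewrite wmulwV window1; lia.
case: k => n; rewrite /wpowz.
- elim: n j => [|n IH] j /=; first by rewrite window1.
  by rewrite (window_mul_shift _ window_pi) IH; lia.
- rewrite NegzE; elim: n.+1 j => [|m IH] j /=; first by rewrite window1; lia.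
  by rewrite (window_mul_shift _ piV) IH; lia.
Qed.

Lemma pos_root_pow k r : is_root r -> pos_root (wact_root (wpowz piW k) r) = pos_root r.
Proof. by move=> ir; rewrite pos_root_wactE // pos_rootE // !window_pow -addrA ltrD2l. Qed.

Lemma sum_window w : \sum_j window w j = \sum_(j < N) j%:Z + N%:Z * degree w.
Proof.
rewrite /window big_split /= -mulr_sumr /degree; congr (_ + _ * _).
  by rewrite [RHS](reindex_inj (@perm_inj _ w.1)).
by rewrite [RHS](reindex_inj (@perm_inj _ w.1)).
Qed.

Lemma window_degree w (k : int) : (forall j, window w j = k + j%:Z) -> k = degree w.
Proof.
move=> h; have := sum_window w; under eq_bigr do rewrite h.
rewrite big_split /= sumr_const card_ord addrC => /addrI/eqP.
by rewrite -mulr_natl natz -subr_eq0 -mulrBr mulf_eq0 subr_eq0 => /orP[|/eqP//]; lia.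
Qed.

Lemma simple_root_is_root i : is_root (simple_root i).
Proof.
by rewrite /simple_root /is_root; case: ifP => h; rewrite -val_eqE /=; move: h => /=; lia.
Qed.

Lemma simple_root_pos i : pos_root (simple_root i).
Proof. by rewrite /simple_root /pos_root /rootpos; case: ifP; case: i => /= *; lia. Qed.

Lemma wact_simple_root i : wact_root (sgen i) (simple_root i) = opp_root (simple_root i).
Proof.
rewrite /wact_root /wroot /simple_root /sgen /opp_root; case: ifP => h /=.
  by rewrite tpermL tpermR !ffunE /=; congr (_, _, _); lia.
by rewrite tpermL tpermR !ffunE.
Qed.

Lemma pos_root_sgen i r : is_root r -> pos_root r -> r != simple_root i ->
  pos_root (wact_root (sgen i) r).
Proof.
case: r => [[a b] k]; rewrite /is_root /simple_root /wact_root /wroot /sgen /pos_root /rootpos /=.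
move=> ab pr; case: ifP => i0; rewrite !xpair_eqE /= -!val_eqE /= => ne; rewrite ?ffunE.
- have := tperm_val (firsto i) (lasto i) a; have := tperm_val (firsto i) (lasto i) b.
  move: ab pr ne i0 => /=; rewrite -!val_eqE /=.
  move: (val (tperm _ _ a)) (val (tperm _ _ b)) => ta tb.
  by move: (ltn_ord a) (ltn_ord b); move: (nat_of_ord a) (nat_of_ord b) => {a b} m n; lia.
- have := tperm_val (prevo i) i a; have := tperm_val (prevo i) i b.
  move: ab pr ne i0 => /=; rewrite -!val_eqE /=.
  move: (val (tperm _ _ a)) (val (tperm _ _ b)) => ta tb.
  by move: (nat_of_ord a) (nat_of_ord b) (nat_of_ord i) => {a b i} m n p; lia.
Qed.

Lemma sgenK i : wmul (sgen i) (sgen i) = wone.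
Proof.
apply: W_ext => [|j]; first by rewrite /sgen; case: ifP => _ /=; rewrite tperm2.
rewrite /sgen; case: ifP => h /=; rewrite !ffunE //= tpermV.
have := tperm_val (firsto i) (lasto i) j => /=.
by move: (val (tperm _ _ j)) => t; move: (ltn_ord j); move: (nat_of_ord j) => m; lia.
Qed.

Lemma wmulsK i w : wmul (sgen i) (wmul (sgen i) w) = w.
Proof. by rewrite wmulA sgenK wmul1w. Qed.

Lemma winv_sgen i : winv (sgen i) = sgen i.
Proof. by rewrite -[LHS]wmulw1 -(sgenK i) wmulKw. Qed.

Lemma wact_rootV_sgen i w :
  wact_root (winv (wmul (sgen i) w)) (simple_root i) =
    opp_root (wact_root (winv w) (simple_root i)).
Proof. by rewrite winvM winv_sgen wact_rootM wact_simple_root wact_root_opp. Qed.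

End Windows.

Section Length.
Variable N : nat.
Implicit Types (x w : W N) (i a b : 'I_N) (r : affine_root N).

Definition inversions w : seq (affine_root N) :=
  [seq r <- [seq (p.1.1, p.1.2, (val p.2)%:Z) | p <- enum [set: 'I_N * 'I_N * 'I_(lbound w).+1]]
     | inS w r.1.1 r.1.2 r.2].

Lemma inversions_uniq w : uniq (inversions w).
Proof.
apply: filter_uniq; rewrite map_inj_uniq ?enum_uniq //.
by move=> [[a b] k] [[a' b'] k'] /= [-> -> /val_inj ->].
Qed.

Lemma wlength_size w : wlength w = size (inversions w).
Proof.
rewrite /inversions size_filter count_map -sum1_count big_mkcond /= big_enum_cond /=.
rewrite /wlength pair_bigA /= pair_bigA /=.
by apply: eq_big => [p|p _]; rewrite ?inE //=; case: ifP.
Qed.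

Lemma inSE w r : inS w r.1.1 r.1.2 r.2 = [&& is_root r, pos_root r & ~~ pos_root (wact_root w r)].
Proof.
rewrite /inS /rootneg -/(wact_root w r) -/(pos_root r) -/(pos_root (wact_root w r)).
by rewrite -/(is_root r) -/(is_root (wact_root w r)) is_root_wact; case: (is_root r).
Qed.

Lemma lbound_ge w a b : a != b -> (`|w.2 a| + `|w.2 b| <= lbound w)%N.
Proof.
move=> ab; rewrite /lbound (bigD1 a) //= (bigD1 b) /=; last by rewrite eq_sym.
by rewrite addnA leq_addr.
Qed.

Lemma mem_inversions w r :
  (r \in inversions w) = [&& is_root r, pos_root r & ~~ pos_root (wact_root w r)].
Proof.
rewrite mem_filter inSE andb_idr // => /and3P[].
case: r => [[a b] k] ir pr nr.
have uab : w.1 a != w.1 b by rewrite (inj_eq perm_inj).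
have := lbound_ge w uab; move: ir pr nr uab.
rewrite /is_root /pos_root /rootpos /wact_root /wroot /= -!val_eqE /= => ir pr nr uab hl.
have kl : (`|k| < (lbound w).+1)%N by move: uab nr hl ir pr; lia.
apply/mapP; exists (a, b, Ordinal kl); first by rewrite mem_enum inE.
by rewrite /= gez0_abs //; move: pr; lia.
Qed.

Hypothesis N2 : (2 <= N)%N.

Lemma inversions_sgen_sub i w r : r \in inversions (wmul (sgen i) w) ->
  r = wact_root (winv w) (simple_root i) \/ r \in inversions w.
Proof.
rewrite !mem_inversions wact_rootM => /and3P[ir pr]; rewrite ir pr /=.
case pw: (pos_root (wact_root w r)); last by right.
have [/eqP/(canRL (wact_rootK w))-> _|ne] := boolP (wact_root w r == simple_root i); first by left.
by rewrite (pos_root_sgen N2) ?is_root_wact.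
Qed.

Lemma wlength_sgen_le i w : (wlength (wmul (sgen i) w) <= (wlength w).+1)%N.
Proof.
rewrite !wlength_size.
apply: (@uniq_leq_size _ _ (wact_root (winv w) (simple_root i) :: inversions w)) => [|r].
  exact: inversions_uniq.
by rewrite inE => /inversions_sgen_sub[->|->]; rewrite ?eqxx ?orbT.
Qed.

Lemma wlength_sgen_lt i w : ~~ pos_root (wact_root (winv w) (simple_root i)) ->
  (wlength (wmul (sgen i) w) < wlength w)%N.
Proof.
move=> nr; set r0 := opp_root (wact_root (winv w) (simple_root i)).
have isr := simple_root_is_root N2 i; have psr := simple_root_pos N2 i.
have ir0 : is_root r0 by rewrite is_root_opp is_root_wact.
have wr0 : wact_root w r0 = opp_root (simple_root i) by rewrite /r0 wact_root_opp wact_rootVK.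
have nS : r0 \notin inversions (wmul (sgen i) w).
  by rewrite mem_inversions wact_rootM wr0 wact_root_opp wact_simple_root // opp_rootK psr !andbF.
rewrite !wlength_size; apply: (@uniq_leq_size _ (r0 :: inversions _)) => [|r].
  by rewrite /= nS inversions_uniq.
rewrite inE => /orP[/eqP->|rS].
  by rewrite mem_inversions ir0 wr0 !pos_root_opp ?is_root_wact ?psr ?nr.
have [rE|//] := inversions_sgen_sub rS.
by move: rS; rewrite mem_inversions rE (negPf nr) andbF.
Qed.

Lemma wlength_sgen_gt i w : pos_root (wact_root (winv w) (simple_root i)) ->
  (wlength w < wlength (wmul (sgen i) w))%N.
Proof.
move=> pr; rewrite -{1}(wmulsK N2 i w); apply: wlength_sgen_lt.
by rewrite wact_rootV_sgen // pos_root_opp ?is_root_wact ?simple_root_is_root // pr.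
Qed.

Lemma wlengthV w : wlength (winv w) = wlength w.
Proof.
suff le (y : W N) : (wlength y <= wlength (winv y))%N.
  apply/eqP; rewrite eqn_leq (le w) andbT.
  by have := le (winv w); rewrite winvK.
rewrite !wlength_size -(size_map (fun r => opp_root (wact_root y r))); apply: uniq_leq_size.
  rewrite map_inj_uniq ?inversions_uniq // => r1 r2 /(can_inj (@opp_rootK N)).
  exact: wact_root_inj.
move=> _ /mapP[r rS ->]; move: rS; rewrite !mem_inversions => /and3P[ir pr nr].
by rewrite is_root_opp is_root_wact ir wact_root_opp wact_rootK !pos_root_opp ?is_root_wact ?nr ?pr.
Qed.

Lemma wlength_mulr_lt i w : ~~ pos_root (wact_root w (simple_root i)) ->
  (wlength (wmul w (sgen i)) < wlength w)%N.
Proof.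
move=> nr; rewrite -wlengthV -[X in (_ < X)%N]wlengthV winvM winv_sgen //.
by apply: wlength_sgen_lt; rewrite winvK.
Qed.

Definition wword (js : seq 'I_N) : W N := foldr wmul wone (map sgen js).

Fixpoint word_roots (js : seq 'I_N) : seq (affine_root N) :=
  if js is i :: js' then wact_root (winv (wword js')) (simple_root i) :: word_roots js' else [::].

Lemma inversions_wword_sub js : {subset inversions (wword js) <= word_roots js}.
Proof.
elim: js => [|i js IH] r /=; first by rewrite mem_inversions wact_root1 => /and3P[_ ->].
by rewrite inE => /inversions_sgen_sub[->|/IH->]; rewrite ?eqxx ?orbT.
Qed.

Lemma inversions_pow k w : inversions (wmul (wpowz piW k) w) =i inversions w.
Proof.
move=> r; rewrite !mem_inversions wact_rootM; case ir: (is_root r) => //=.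
by rewrite pos_root_pow ?is_root_wact.
Qed.

Lemma word_roots_red x rd : is_red x rd -> {subset word_roots rd.2 <= inversions x}.
Proof.
move=> [xE sz] r.
have sub : {subset inversions x <= word_roots rd.2}.
  by move=> r'; rewrite xE inversions_pow => /inversions_wword_sub.
have szr : size (word_roots rd.2) = size rd.2 by elim: rd.2 => //= i js ->.
have le : (size (word_roots rd.2) <= size (inversions x))%N by rewrite szr sz wlength_size.
by have [_ ->] := uniq_min_size (inversions_uniq x) sub le.
Qed.

End Length.

Section FiniteOrAffine.
Variables (N : nat) (affine : bool).
Hypothesis N2 : (2 <= N)%N.
Implicit Types (x y w : W N) (i : 'I_N) (r : affine_root N).

(* [affine = true] stands for W and all its roots, [affine = false] for the finite group [S_N]
   and the roots without [delta] component. *)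
Definition simple_index i := affine || (val i != 0%N).
Definition rotation_index (k : int) := affine || (k == 0).
Definition in_weyl w := affine || (w.2 == [ffun => 0]).
Definition in_roots r := affine || (r.2 == 0).

Lemma in_weyl1 : in_weyl wone. Proof. by rewrite /in_weyl eqxx orbT. Qed.

Lemma in_weylM x y : in_weyl x -> in_weyl y -> in_weyl (wmul x y).
Proof.
rewrite /in_weyl; case: affine => //= /eqP hx /eqP hy; apply/eqP/ffunP => j.
by rewrite !ffunE hx hy !ffunE.
Qed.

Lemma in_weylV x : in_weyl x -> in_weyl (winv x).
Proof.
rewrite /in_weyl; case: affine => //= /eqP hx; apply/eqP/ffunP => j.
by rewrite !ffunE hx !ffunE oppr0.
Qed.

Lemma in_weyl_sgen i : simple_index i -> in_weyl (sgen i).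
Proof. by rewrite /simple_index /in_weyl /sgen; case: affine => //= /negPf ->. Qed.

Lemma in_weyl_pow k : rotation_index k -> in_weyl (wpowz piW k).
Proof. by rewrite /rotation_index => /orP[h|/eqP->]; [rewrite /in_weyl h|exact: in_weyl1]. Qed.

Lemma in_roots_wact w r : in_weyl w -> in_roots r -> in_roots (wact_root w r).
Proof.
rewrite /in_weyl /in_roots; case: affine => //= /eqP w0 /eqP r0.
by rewrite /wact_root /wroot /= w0 r0 !ffunE.
Qed.

Lemma in_roots_opp r : in_roots (opp_root r) = in_roots r.
Proof. by rewrite /in_roots /= oppr_eq0. Qed.

Lemma in_roots_simple i : simple_index i -> in_roots (simple_root i).
Proof. by rewrite /in_roots /simple_index /simple_root; case: affine => //= /negPf ->. Qed.

Lemma no_left_descent_pow w : in_weyl w ->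
  (forall i, simple_index i -> pos_root (wact_root (winv w) (simple_root i))) ->
  rotation_index (degree w) /\ w = wpowz piW (degree w).
Proof.
move=> iw nd; have inc i : val i != 0%N -> window (winv w) (prevo i) < window (winv w) i.
  move=> i0; have := nd i; rewrite /simple_index i0 orbT => /(_ isT).
  rewrite pos_root_wactE ?simple_root_is_root // /simple_root (negPf i0) /=; lia.
have short i : window (winv w) (lasto i) < window (winv w) (firsto i) + N%:Z.
  have := nd (firsto i); rewrite /simple_index; have /= := in_weylV iw; rewrite /in_weyl.
  case: affine => [_ /(_ isT)|/= /eqP v0 _]; last first.
    rewrite /window /= v0 !ffunE; have := ltn_ord ((w.1)^-1%g (lasto i)); lia.
  rewrite pos_root_wactE ?simple_root_is_root // /simple_root /= mulr1.
  have -> : lasto (firsto i) = lasto i by apply: val_inj.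
  by have -> : firsto (firsto i) = firsto i by apply: val_inj.
have N0 : (0 < N)%N by lia.
pose o : 'I_N := Ordinal N0; pose c := window (winv w) o.
have shift j : window (winv w) j = c + j%:Z.
  by rewrite (increasing_short_span inc short); congr (window _ _ + _); apply: val_inj.
have cE : c = - degree w by rewrite (window_degree N2 shift) degreeV.
split.
  move: iw; rewrite /in_weyl /rotation_index => /orP[->//|/eqP w0].
  by apply/orP; right; rewrite /degree big1 // => j _; rewrite w0 ffunE.
apply/wmul_eq1/(window_inj N2) => j.
by rewrite (window_mul_shift _ shift) window_pow // cE addKr.
Qed.

End FiniteOrAffine.

Section Selectors.
Variables (N : nat) (sel : 'I_N -> bool).
Implicit Types (w y : W N) (i j a b p : 'I_N) (r : affine_root N).

Definition cuts j : nat := \sum_(i < N | (0 < i <= j)%N) ~~ sel i.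

Lemma cuts_prev i : val i != 0%N -> cuts i = (cuts (prevo i) + ~~ sel i)%N.
Proof.
move=> i0; rewrite /cuts (bigD1 i) /=; last by move: i0 => /=; lia.
rewrite addnC; congr (_ + _)%N; apply: eq_bigl => j; rewrite -val_eqE /=.
by move: i0 => /=; lia.
Qed.

Lemma cuts_prev_sel i : val i != 0%N -> sel i -> cuts (prevo i) = cuts i.
Proof. by move=> i0 si; rewrite [RHS]cuts_prev // si addn0. Qed.

Lemma cuts_mono a b : (a <= b)%N -> (cuts a <= cuts b)%N.
Proof.
have := @adjacent_le_homo N (fun j => (cuts j)%:Z) _ a b; rewrite /= lez_nat; apply.
by move=> i i0; rewrite (cuts_prev i0) lez_nat leq_addr.
Qed.

Lemma cuts_lt j : (cuts j < N)%N.
Proof.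
apply: leq_ltn_trans (ltn_ord j); move: j; apply: ord_prev_ind => [j j0|i i0 IH].
  by rewrite /cuts big1 // => i; rewrite j0; lia.
by rewrite cuts_prev //; move: IH i0 => /=; case: (sel i) => /=; lia.
Qed.

Lemma sameblkE a b : sameblk sel a b = (cuts a == cuts b).
Proof.
wlog ab : a b / (a <= b)%N => [h|].
  by case: (leqP a b) => [/h //|/ltnW/h]; rewrite /sameblk minnC maxnC eq_sym.
rewrite /sameblk (minn_idPl ab) (maxn_idPr ab) /cuts.
rewrite [X in _ == X](bigID (fun i : 'I_N => i <= a)%N) /=.
rewrite [X in (X + _)%N](eq_bigl (fun i : 'I_N => 0 < i <= a)%N); last by move=> i /=; lia.
rewrite -[X in X == _]addn0 eqn_add2l eq_sym sum_nat_eq0; apply: eq_forallb => i.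
by rewrite eqb0 negbK -andbA -ltnNge; congr (_ ==> _); move: ab; lia.
Qed.

(* The sum of the coefficients of [r] on the simple roots outside [\bar\Pi_sel]: [delta]
   counts for [N], more than the number of blocks, so that the sign decides positivity. *)
Definition block_height r : int := (cuts r.1.2)%:Z - (cuts r.1.1)%:Z + N%:Z * r.2.

Lemma block_height_opp r : block_height (opp_root r) = - block_height r.
Proof. by rewrite /block_height /=; ring. Qed.

Lemma pos_root_block_height r : is_root r -> 0 < block_height r -> pos_root r.
Proof.
case: r => [[a b] k]; rewrite /is_root /block_height /pos_root /rootpos -val_eqE /=.
have := @cuts_mono b a; have := cuts_lt a; have := cuts_lt b.
by case: (mulz_signP N k) => [[]|->|[]]; lia.
Qed.

Lemma block_height_ge0 r : is_root r -> pos_root r -> 0 <= block_height r.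
Proof.
move=> ir pr; rewrite leNgt -oppr_gt0 -block_height_opp; apply/negP.
by move=> /pos_root_block_height; rewrite is_root_opp pos_root_opp // ir pr => /(_ isT).
Qed.

Lemma block_height_eq0 r : is_root r ->
  (block_height r == 0) = (r.2 == 0) && (cuts r.1.1 == cuts r.1.2).
Proof.
move=> ir; rewrite /block_height; have := cuts_lt r.1.1; have := cuts_lt r.1.2.
by case: (mulz_signP N r.2) => [[]|->|[]]; lia.
Qed.

Lemma inRgpE r : is_root r ->
  inRgp sel r.1.1 r.1.2 r.2 = pos_root r && (block_height r == 0).
Proof.
move=> ir; rewrite block_height_eq0 // /inRgp sameblkE /pos_root /rootpos.
by case: eqP => [->|]; rewrite ?andbF //=; lia.
Qed.

Lemma block_height_gt0 r : is_root r ->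
  (0 < block_height r) = pos_root r && ~~ inRgp sel r.1.1 r.1.2 r.2.
Proof.
move=> ir; rewrite inRgpE //; case pr: (pos_root r) => /=.
  by rewrite lt0r block_height_ge0 ?andbT.
by apply/negP => /(pos_root_block_height ir); rewrite pr.
Qed.

Lemma block_height_simple p : val p != 0%N -> sel p -> block_height (simple_root p) = 0.
Proof.
by move=> p0 sp; rewrite /simple_root (negPf p0) /block_height /= cuts_prev_sel //; ring.
Qed.

Lemma block_height_sgen p r : val p != 0%N -> sel p ->
  block_height (wact_root (sgen p) r) = block_height r.
Proof.
move=> p0 sp; have cp := cuts_prev_sel p0 sp.
have ct j : cuts (tperm (prevo p) p j) = cuts j by case: tpermP => [->|->|].
by rewrite /wact_root /wroot /sgen (negPf p0) /block_height /= !ct !ffunE; ring.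
Qed.

Lemma block_height_Wbar y r : in_Wbar_gamma sel y ->
  block_height (wact_root y r) = block_height r.
Proof.
move=> [js [sjs ->]]; elim: js sjs => [|p js IH] /=; first by rewrite wact_root1.
by move=> /andP[/andP[p0 sp] /IH h]; rewrite wact_rootM block_height_sgen.
Qed.

Lemma in_Wbar_sgen p : val p != 0%N -> sel p -> in_Wbar_gamma sel (sgen p).
Proof. by move=> p0 sp; exists [:: p]; rewrite /= p0 sp wmulw1. Qed.

End Selectors.

Section MinimalRepresentatives.
Variables (N : nat) (sel : 'I_N -> bool).
Hypothesis N2 : (2 <= N)%N.
Implicit Types (w y : W N) (i a b p : 'I_N) (r : affine_root N).
Local Notation ht := (block_height sel).

Definition min_rep w :=
  [forall p : 'I_N, (val p != 0%N) && sel p ==> pos_root (wact_root w (simple_root p))].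

Lemma min_repPn w :
  ~~ min_rep w -> exists p, [/\ val p != 0%N, sel p & ~~ pos_root (wact_root w (simple_root p))].
Proof.
by rewrite negb_forall => /existsP[p]; rewrite negb_imply => /andP[/andP[? ?] ?]; exists p.
Qed.

Lemma min_rep_pow k : min_rep (wpowz piW k).
Proof.
apply/forallP => p; apply/implyP => _.
by rewrite pos_root_pow ?simple_root_is_root ?simple_root_pos.
Qed.

Lemma min_rep_window w a b : min_rep w -> (a <= b)%N -> sameblk sel a b ->
  window w a - a%:Z <= window w b - b%:Z.
Proof.
rewrite leq_eqVlt => mw /orP[/eqP/val_inj-> //|ab].
apply: (sameblk_homo (R := fun m n => m <= n) (f := fun j => window w j - j%:Z)) ab.
  by move=> y x z; apply: le_trans.
move=> i i0 si; have /forallP/(_ i) := mw; rewrite i0 si /= pos_root_wactE ?simple_root_is_root //.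
by rewrite /simple_root (negPf i0) mulr0 addr0 /=; move: i0 => /=; lia.
Qed.

Lemma min_rep_pos_root w r : min_rep w -> is_root r -> ht r = 0 ->
  pos_root (wact_root w r) = pos_root r.
Proof.
move=> mw ir /eqP; rewrite block_height_eq0 // pos_root_wactE // pos_rootE //.
case: r ir => [[a b] k]; rewrite /is_root -val_eqE /= => ab /andP[/eqP-> cab].
have := @min_rep_window w a b mw; have := @min_rep_window w b a mw.
by rewrite !sameblkE (eqP cab) eqxx; case: (leqP a b) => h; move: ab; lia.
Qed.

Lemma min_rep_sgen i w : min_rep w ->
  min_rep (wmul (sgen i) w) = (ht (wact_root (winv w) (simple_root i)) != 0).
Proof.
move=> mw; set r := wact_root _ _.
have ir : is_root r by rewrite is_root_wact simple_root_is_root.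
apply/idP/idP => [ms|hn0].
  apply/eqP => h0; have := min_rep_pos_root ms ir h0.
  rewrite -(min_rep_pos_root mw ir h0) wact_rootM wact_rootVK.
  by rewrite wact_simple_root // pos_root_opp ?simple_root_is_root // simple_root_pos.
apply/idPn => /min_repPn[p [p0 sp]]; rewrite wact_rootM => np; case/eqP: hn0.
suff rE : r = simple_root p by rewrite rE block_height_simple.
apply/(canLR (wact_rootK w))/esym/eqP; apply: contraNT np; apply: pos_root_sgen => //.
  by rewrite is_root_wact simple_root_is_root.
rewrite min_rep_pos_root ?simple_root_is_root ?simple_root_pos //; exact: block_height_simple.
Qed.

(* Along left multiplications that increase the length inside [W^sel], the root inverted last is
   never in a block: this is what makes the corresponding intertwiners invertible. *)
Lemma min_rep_ind (affine : bool) (P : W N -> Prop) :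
  (forall k, rotation_index affine k -> P (wpowz piW k)) ->
  (forall i w, simple_index affine i -> in_weyl affine w -> min_rep w ->
     0 < ht (wact_root (winv w) (simple_root i)) -> P w -> P (wmul (sgen i) w)) ->
  forall w, in_weyl affine w -> min_rep w -> P w.
Proof.
move=> Ppow Psgen w; have [n] := ubnP (wlength w); elim: n w => // n IH w len iw mw.
case e: [exists i, simple_index affine i && ~~ pos_root (wact_root (winv w) (simple_root i))].
  have /existsP[i /andP[si ri]] := e; set r := wact_root _ _ in ri.
  have ir : is_root r by rewrite is_root_wact simple_root_is_root.
  have pr' : pos_root (opp_root r) by rewrite pos_root_opp.
  have h : ht r != 0.
    apply: contra ri => /eqP h0; rewrite -(min_rep_pos_root mw ir h0) wact_rootVK.
    exact: simple_root_pos.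
  rewrite -(wmulsK N2 i w); apply: Psgen => //.
  - by apply: in_weylM => //; apply: in_weyl_sgen.
  - by rewrite min_rep_sgen.
  - rewrite wact_rootV_sgen // lt0r block_height_ge0 ?is_root_opp // andbT.
    by rewrite block_height_opp oppr_eq0.
  - apply: IH; last by rewrite min_rep_sgen.
      exact: leq_trans (wlength_sgen_lt N2 ri) len.
    by apply: in_weylM => //; apply: in_weyl_sgen.
have [|k ->] := no_left_descent_pow N2 iw; last exact: Ppow.
by move=> i si; have /negbT/existsPn/(_ i) := e; rewrite si negbK.
Qed.

Lemma min_rep_inversion w r : min_rep w -> r \in inversions w -> 0 < ht r.
Proof.
move=> mw; rewrite mem_inversions => /and3P[ir pr nr].
by rewrite lt0r block_height_ge0 // andbT; apply: contra nr => /eqP h0; rewrite min_rep_pos_root.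
Qed.

Lemma min_rep_wlength w y : min_rep w -> in_Wbar_gamma sel y ->
  (wlength w <= wlength (wmul w y))%N.
Proof.
move=> mw hy; rewrite !wlength_size -(size_map (wact_root (winv y))); apply: uniq_leq_size.
  by rewrite map_inj_uniq ?inversions_uniq //; exact: wact_root_inj.
move=> _ /mapP[r rS ->]; have hr := min_rep_inversion mw rS.
move: rS; rewrite !mem_inversions => /and3P[ir _ nr].
have ir' : is_root (wact_root (winv y) r) by rewrite is_root_wact.
rewrite ir' wact_rootM wact_rootVK nr andbT (pos_root_block_height (sel := sel)) //.
by rewrite -(block_height_Wbar _ hy) wact_rootVK.
Qed.

Lemma in_WsupP w : in_Wsup sel w <-> min_rep w.
Proof.
split=> [hw|mw y hy]; last exact: min_rep_wlength.
apply/idPn => /min_repPn[p [p0 sp np]].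
have := hw _ (in_Wbar_sgen p0 sp); rewrite leqNgt => /negP; apply.
exact: wlength_mulr_lt.
Qed.

End MinimalRepresentatives.

Lemma weyl_ind (N : nat) (affine : bool) (P : W N -> Prop) : (2 <= N)%N ->
  (forall k, rotation_index affine k -> P (wpowz piW k)) ->
  (forall i w, simple_index affine i -> in_weyl affine w ->
     (wlength w < wlength (wmul (sgen i) w))%N -> P w -> P (wmul (sgen i) w)) ->
  forall w, in_weyl affine w -> P w.
Proof.
move=> N2 Ppow Psgen w iw; apply: (min_rep_ind N2 (sel := xpred0) Ppow _ iw); last first.
  by apply/forallP => p; rewrite andbF.
move=> {iw}i {}w si iw _ hr; apply: Psgen => //; apply: wlength_sgen_gt => //.
by apply: pos_root_block_height hr; rewrite is_root_wact simple_root_is_root.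
Qed.

(** * The index set [X^beta] *)

Section DominantRepresentatives.
Variables (N : nat) (sel : 'I_N -> bool).
Hypothesis N2 : (2 <= N)%N.
Implicit Types (x y w : W N) (i j a b p : 'I_N) (r : affine_root N) (u : 'S_N).
Local Notation ht := (block_height sel).

Definition level x j : int := (cuts sel ((x.1^-1)%g j))%:Z - N%:Z * x.2 j.

Lemma block_height_winv x a b :
  ht (wact_root (winv x) (a, b, 0)) = level x b - level x a.
Proof. by rewrite wact_rootVE /block_height /level /=; ring. Qed.

Lemma block_height_winv_simple x i : val i != 0%N ->
  ht (wact_root (winv x) (simple_root i)) = level x i - level x (prevo i).
Proof. by rewrite /simple_root => /negPf->; rewrite block_height_winv. Qed.

Definition dominant_rep x := min_rep sel x && [forall i : 'I_N, (val i != 0%N) ==>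
  (ht (wact_root (winv x) (simple_root i)) <= 0)].

Lemma dominant_rep_min x : dominant_rep x -> min_rep sel x.
Proof. by case/andP. Qed.

Lemma adjacent_level_anti x :
  (forall i, val i != 0%N -> ht (wact_root (winv x) (simple_root i)) <= 0) ->
  forall a b, (a <= b)%N -> level x b <= level x a.
Proof.
move=> dx a b ab; rewrite -lerN2; apply: (adjacent_le_homo (f := fun j => - level x j)) ab => i i0.
by have := dx i i0; rewrite block_height_winv_simple // subr_le0 lerN2.
Qed.

Lemma level_anti x a b : dominant_rep x -> (a <= b)%N -> level x b <= level x a.
Proof.
move=> /andP[_ /forallP dx]; apply: adjacent_level_anti => i i0.
by have := dx i; rewrite i0.
Qed.

Lemma level_translation_le x a b : level x b <= level x a -> x.2 a <= x.2 b.
Proof.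
have := cuts_lt sel ((x.1^-1)%g a); have := cuts_lt sel ((x.1^-1)%g b).
rewrite /level; have -> : N%:Z * x.2 b = N%:Z * x.2 a + N%:Z * (x.2 b - x.2 a) by ring.
by case: (mulz_signP N (x.2 b - x.2 a)) => [[]|/eqP|[]]; rewrite ?subr_eq0; lia.
Qed.

Definition crosses_blocks u i := [exists a : 'I_N, exists b : 'I_N,
  [&& (val a < val b)%N, ~~ sameblk sel a b, u a == prevo i & u b == i]].

Lemma crosses_blocksE u i :
  crosses_blocks u i = (cuts sel ((u^-1)%g (prevo i)) < cuts sel ((u^-1)%g i))%N.
Proof.
apply/existsP/idP => [[a /existsP[b /and4P[ab nab /eqP<- /eqP<-]]]|h].
  by rewrite !permK ltn_neqAle -sameblkE nab cuts_mono // ltnW.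
exists ((u^-1)%g (prevo i)); apply/existsP; exists ((u^-1)%g i).
rewrite !permKV !eqxx sameblkE !andbT neq_ltn h andbT.
by rewrite ltnNge; apply/negP => /(cuts_mono sel); rewrite leqNgt h.
Qed.

Lemma min_rep_finite x u : x.1 = u -> (forall a b, (a <= b)%N -> x.2 a <= x.2 b) ->
  min_rep sel (u, [ffun => 0]) -> min_rep sel x.
Proof.
move=> <- mono /forallP mu; apply/forallP => p; apply/implyP => hp.
have := mu p; rewrite hp; case/andP: hp => p0 _; rewrite /simple_root (negPf p0).
rewrite /pos_root /rootpos /wact_root /wroot /= !ffunE !subrr lexx ltxx andbT andbF orbF.
by move=> lt; rewrite lt /= sub0r oppr_ge0 subr_le0 mono // ltnW.
Qed.

Lemma in_X_dominant x : in_X sel x -> dominant_rep x.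
Proof.
move=> [u [eta0 [etaw [[/(in_WsupP _ N2) mu _] dom [_ hw] ->]]]]; set x' := (u, _).
have dx i : val i != 0%N -> ht (wact_root (winv x') (simple_root i)) <= 0.
  move=> i0; rewrite block_height_winv_simple // subr_le0.
  have := hw i i0; rewrite -/(crosses_blocks u i) crosses_blocksE /level /= !ffunE.
  have : eta0 (prevo i) <= eta0 i by apply: dom; move: i0 => /=; lia.
  have := cuts_lt sel ((u^-1)%g i); have := cuts_lt sel ((u^-1)%g (prevo i)).
  move dE : (eta0 i + etaw i - (eta0 (prevo i) + etaw (prevo i))) => d.
  have -> : N%:Z * (eta0 i + etaw i) = N%:Z * (eta0 (prevo i) + etaw (prevo i)) + N%:Z * d.
    by rewrite -dE; ring.
  by case: (ltnP (cuts _ _) (cuts _ _)) => ?;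
    case: (mulz_signP N d) => [[]|d0|[]]; rewrite ?d0; lia.
apply/andP; split; last by apply/forallP => i; apply/implyP => /dx.
by apply: (min_rep_finite (u := u)) => // a b /(adjacent_level_anti dx)/level_translation_le.
Qed.

Lemma dominant_min_rep_finite x : dominant_rep x -> min_rep sel (x.1, [ffun => 0]).
Proof.
move=> dx; have /forallP mx := dominant_rep_min dx.
apply/forallP => p; apply/implyP => hp; have := mx p; rewrite hp; case/andP: hp => p0 sp.
rewrite /simple_root (negPf p0) /pos_root /rootpos /wact_root /wroot /= !ffunE !subrr.
rewrite lexx ltxx andbT andbF orbF => /orP[/andP[//]|/andP[lt]].
have /level_translation_le := level_anti dx (ltnW lt).
by rewrite sub0r oppr_gt0 subr_lt0 => h /(le_lt_trans h); rewrite ltxx.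
Qed.

Lemma dominant_in_X x : dominant_rep x -> in_X sel x.
Proof.
move=> dx; pose u := x.1.
pose etaw : {ffun 'I_N -> int} :=
  [ffun j : 'I_N => \sum_(i < N | (0 < i <= j)%N) (nat_of_bool (crosses_blocks u i))%:Z].
have etawP i : val i != 0%N -> etaw (prevo i) - etaw i = if crosses_blocks u i then -1 else 0.
  move=> i0; rewrite !ffunE [X in _ - X](bigD1 i) /=; last by move: i0 => /=; lia.
  rewrite opprD addrCA -[RHS]addr0; congr +%R; first by case: crosses_blocks.
  apply/eqP; rewrite subr_eq0; apply/eqP; apply: eq_bigl => j.
  by move: i0; rewrite -val_eqE /=; lia.
exists u, [ffun j => x.2 j - etaw j], etaw; split.
- by split=> //; apply/(in_WsupP _ N2)/dominant_min_rep_finite.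
- move=> a b /ltnW; apply: adjacent_le_homo => i i0; rewrite ![[ffun j => x.2 j - _] _]ffunE.
  have := etawP i i0; rewrite crosses_blocksE.
  have lp : (prevo i <= i)%N by exact: leq_pred.
  have lev := level_anti dx lp; have tr := level_translation_le lev.
  case: (ltnP (cuts _ _) (cuts _ _)) => cross; last by lia.
  suff : x.2 (prevo i) != x.2 i by lia.
  by apply/eqP => e; move: lev; rewrite /level -/u e; lia.
- split; last exact: etawP.
  by move=> i i0; rewrite ffunE big1 // => j; rewrite i0; lia.
- by apply: W_ext => // j; rewrite !ffunE subrK.
Qed.

Lemma in_XP x : in_X sel x <-> dominant_rep x.
Proof. by split; [exact: in_X_dominant|exact: dominant_in_X]. Qed.

(* Positions are sorted first by decreasing level, then by increasing preimage. *)
Definition sort_key x j : int := ((x.1)^-1%g j)%:Z - N%:Z * level x j.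

Lemma sort_key_incr x a b : dominant_rep x -> (a < b)%N -> sort_key x a < sort_key x b.
Proof.
move=> dx ab; have := level_anti dx (ltnW ab); rewrite /sort_key.
have -> : N%:Z * level x a = N%:Z * level x b + N%:Z * (level x a - level x b) by ring.
have := ltn_ord ((x.1)^-1%g a); have := ltn_ord ((x.1)^-1%g b).
case: (mulz_signP N (level x a - level x b)) => [[]|lab|[]]; [lia| |lia] => _ _ _.
have ir : is_root (wact_root (winv x) (a, b, 0)) by rewrite is_root_wact /is_root neq_ltn /= ab.
have h0 : ht (wact_root (winv x) (a, b, 0)) = 0.
  by rewrite block_height_winv -opprB lab oppr0.
have := min_rep_pos_root N2 (dominant_rep_min dx) ir h0.
have /eqP := h0; rewrite block_height_eq0 // wact_rootVK [pos_root (_ (winv x) _)]pos_rootE //.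
by rewrite wact_rootVE /pos_root /rootpos /= ab => /andP[/eqP-> _]; lia.
Qed.

Lemma perm_increasing_eq1 u : (forall a b, (a < b)%N -> (u a < u b)%N) -> u = 1%g.
Proof.
move=> inc; have inc' i : val i != 0%N -> (u (prevo i))%:Z < (u i)%:Z.
  by move=> i0; rewrite ltz_nat inc //; move: i0 => /=; lia.
have short i : (u (lasto i))%:Z < (u (firsto i))%:Z + N%:Z by have := ltn_ord (u (lasto i)); lia.
apply/permP => j; rewrite perm1; apply: val_inj => /=.
have := increasing_short_span inc' short j.
have := increasing_short_span inc' short (lasto j); rewrite /=.
have -> : firsto (lasto j) = firsto j by apply: val_inj.
by have := ltn_ord (u (lasto j)); have := ltn_ord j; lia.
Qed.

Lemma dominant_rep_uniq x y u : dominant_rep x -> dominant_rep y ->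
  x = wmul (u, [ffun => 0]) y -> x = y.
Proof.
move=> dx dy xE; suff u1 : u = 1%g by rewrite xE u1; exact: wmul1w.
have keyE j : sort_key x (u j) = sort_key y j.
  by rewrite /sort_key /level xE /= !ffunE /= add0r invMg permM permK.
apply: perm_increasing_eq1 => a b ab; have := sort_key_incr dy ab; rewrite -!keyE.
case: (ltngtP (u a) (u b)) => [//|/(sort_key_incr dx)|/val_inj->]; last by rewrite ltxx.
by move=> h /(lt_trans h); rewrite ltxx.
Qed.

Lemma selBE x i : val i != 0%N -> min_rep sel x ->
  selB sel x i = (ht (wact_root (winv x) (simple_root i)) == 0).
Proof.
move=> i0 mx; have xr := wact_rootVK x (simple_root i).
have ir : is_root (wact_root (winv x) (simple_root i)).
  by rewrite is_root_wact simple_root_is_root.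
move: (wact_root (winv x) _) xr ir => r xr ir.
have sE : simple_root i = (prevo i, i, 0) by rewrite /simple_root (negPf i0).
transitivity (pos_root r && (ht r == 0)); last first.
  case: eqP => [h0|_]; rewrite ?andbF //.
  by rewrite -(min_rep_pos_root N2 mx ir h0) xr simple_root_pos.
rewrite -inRgpE // /selB i0 /=.
apply/existsP/idP => [[a /existsP[b /andP[rab /eqP wab]]]|rR].
  have -> : r = (a, b, 0) by apply: (@wact_root_inj _ x); rewrite xr sE -wab.
  exact: rab.
exists r.1.1; apply/existsP; exists r.1.2; have /and3P[/eqP r0 _ _] := rR.
by rewrite -{1}r0 rR -sE -xr /wact_root r0 eqxx.
Qed.

Lemma sameblk_selB x a b : dominant_rep x -> (a <= b)%N ->
  sameblk (selB sel x) a b = (level x a == level x b).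
Proof.
move=> dx; rewrite leq_eqVlt => /orP[/eqP/val_inj->|ab]; first by rewrite sameblkE !eqxx.
have selBl i : val i != 0%N -> selB sel x i = (level x (prevo i) == level x i).
  move=> i0; rewrite selBE ?dominant_rep_min // block_height_winv_simple //.
  by rewrite subr_eq0 eq_sym.
apply/idP/eqP => [|lab].
  apply: (sameblk_homo (R := eq)) ab => [y p z -> //|i i0].
  by rewrite selBl // => /eqP.
apply/forallP => i; apply/implyP; rewrite (minn_idPl (ltnW ab)) (maxn_idPr (ltnW ab)).
move=> /andP[ai ib].
have i0 : val i != 0%N by move: ai => /=; lia.
have ap : (a <= prevo i)%N by move: ai => /=; lia.
rewrite selBl //; apply/eqP/le_anti; rewrite [X in _ && X]level_anti //; last exact: leq_pred.
by rewrite andbT (le_trans (level_anti dx ap)) // lab level_anti.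
Qed.

(* A root of the block at distance more than 1 would be moved too far by [w]. *)
Lemma min_rep_simple_preimage w i : val i != 0%N -> min_rep sel w ->
  ht (wact_root (winv w) (simple_root i)) = 0 ->
  exists2 p, val p != 0%N /\ sel p & wact_root (winv w) (simple_root i) = simple_root p.
Proof.
move=> i0 mw; set r := wact_root _ _ => h0.
have ir : is_root r by rewrite is_root_wact simple_root_is_root.
have wr : wact_root w r = (prevo i, i, 0) by rewrite /r wact_rootVK /simple_root (negPf i0).
have pr : pos_root r.
  by rewrite -(min_rep_pos_root N2 mw ir h0) wact_rootVK simple_root_pos.
move: ir h0 pr wr; case: (r) => [[a b] k] ir /eqP.
rewrite block_height_eq0 //= => /andP[/eqP-> cab].
rewrite pos_rootE //= mulr0 addr0 ltz_nat => ab wE.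
have sab : sameblk sel a b by rewrite sameblkE.
have ba : val b = (val a).+1.
  have := min_rep_window N2 mw (ltnW ab) sab; move: wE; rewrite /wact_root /wroot /window /=.
  by move=> [-> -> /eqP]; rewrite sub0r oppr_eq0 subr_eq0 => /eqP ->; move: ab i0 => /=; lia.
exists b; first by split; [rewrite ba|move/forallP/(_ b)/implyP: sab; apply; rewrite ba /=; lia].
by rewrite /simple_root ba /=; congr (_, _, _); apply: val_inj; rewrite /= ba.
Qed.

Lemma dominant_rep_ind (P : W N -> Prop) : (forall x, dominant_rep x -> P x) ->
  (forall i w, val i != 0%N -> min_rep sel w ->
     0 < ht (wact_root (winv w) (simple_root i)) -> P (wmul (sgen i) w) -> P w) ->
  forall w, min_rep sel w -> P w.
Proof.
move=> Pdom Pstep w0 mw0; pose orbit (u : 'S_N) : W N := wmul (u, [ffun => 0]) w0.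
pose K := \max_u wlength (orbit u).
suff h n u : (K < wlength (orbit u) + n)%N -> min_rep sel (orbit u) -> P (orbit u).
  by have := h K.+1 1%g; rewrite [orbit _]wmul1w; apply; rewrite // addnS ltnS leq_addl.
elim: n u => [|n IH] u len mu; first by have := leq_bigmax (F := fun u => wlength (orbit u)) u; lia.
have [/Pdom //|] := boolP (dominant_rep (orbit u)).
rewrite /dominant_rep mu /= => /forallPn[i]; rewrite negb_imply -ltNge => /andP[i0 hi].
have sE : wmul (sgen i) (orbit u) = orbit (u * tperm (prevo i) i)%g.
  rewrite /orbit wmulA /sgen (negPf i0); congr wmul; apply: W_ext => // j.
  by rewrite !ffunE addr0.
apply: (Pstep i) => //; rewrite sE; apply: IH; rewrite -sE; last by rewrite min_rep_sgen // gt_eqF.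
have pr : pos_root (wact_root (winv (orbit u)) (simple_root i)).
  by apply: pos_root_block_height hi; rewrite is_root_wact simple_root_is_root.
by have := wlength_sgen_gt N2 pr; lia.
Qed.

End DominantRepresentatives.

(** * Weight vectors and intertwiners *)

Section Subspaces.
Variables (F : fieldType) (V : lmodType F).
Implicit Types (Q S : V -> Prop) (u v : V).

Definition subspace Q :=
  [/\ Q 0, forall u v, Q u -> Q v -> Q (u + v) & forall a u, Q u -> Q (a *: u)].

Definition lspan S v := forall Q, subspace Q -> (forall u, S u -> Q u) -> Q v.

Lemma lspan_subspace S : subspace (lspan S).
Proof.
split=> [Q [] //|u v hu hv Q sQ SQ|a u hu Q sQ SQ]; have [_ QD QZ] := sQ.
  by apply: QD; [apply: hu|apply: hv].
by apply: QZ; apply: hu.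
Qed.

Lemma lspan0 S : lspan S 0.
Proof. by case: (lspan_subspace S). Qed.

Lemma lspan_ind S Q : subspace Q -> (forall u, S u -> Q u) -> forall v, lspan S v -> Q v.
Proof. by move=> sQ SQ v; apply. Qed.

Lemma mem_lspan S v : S v -> lspan S v.
Proof. by move=> Sv Q _; apply. Qed.

Lemma subspaceB Q u v : subspace Q -> Q u -> Q v -> Q (u - v).
Proof. by move=> [_ QD QZ] Qu Qv; rewrite -scaleN1r; apply/QD/QZ. Qed.

Lemma subspace_unscale Q a u : subspace Q -> a != 0 -> Q (a *: u) -> Q u.
Proof. by move=> [_ _ QZ] a0 /(QZ a^-1); rewrite scalerA mulVf // scale1r. Qed.

Lemma subspace_sum Q (I : eqType) (s : seq I) (g : I -> V) :
  subspace Q -> (forall i, i \in s -> Q (g i)) -> Q (\sum_(i <- s) g i).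
Proof.
move=> [Q0 QD _] Qg; rewrite big_seq; elim/big_ind: _ => // i /Qg; exact.
Qed.

Lemma subspace0 : subspace (fun v => v = 0).
Proof. by split=> [|u v -> ->|a u ->]; rewrite ?addr0 ?scaler0. Qed.

Lemma subspace_line v : subspace (fun u => exists c, u = c *: v).
Proof.
split=> [|u w [c ->] [d ->]|a u [c ->]]; first by exists 0; rewrite scale0r.
  by exists (c + d); rewrite scalerDl.
by exists (a * c); rewrite scalerA.
Qed.

Lemma subspaceI Q S : subspace Q -> subspace S -> subspace (fun v => Q v /\ S v).
Proof.
move=> [Q0 QD QZ] [S0 SD SZ]; split=> // [u v [Qu Su] [Qv Sv]|a u [Qu Su]].
  by split; [exact: QD|exact: SD].
by split; [exact: QZ|exact: SZ].
Qed.

Lemma lspan_seq S v : (forall a u, S u -> S (a *: u)) -> lspan S v ->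
  exists2 s : seq V, forall u, u \in s -> S u & v = \sum_(u <- s) u.
Proof.
move=> SZ; move: v; apply: lspan_ind => [|u Su]; last first.
  by exists [:: u]; rewrite ?big_seq1 // => w; rewrite inE => /eqP->.
split=> [|u w [s hs ->] [t ht ->]|a u [s hs ->]]; first by exists [::]; rewrite ?big_nil.
  by exists (s ++ t); rewrite ?big_cat // => y; rewrite mem_cat => /orP[/hs|/ht].
exists [seq a *: w | w <- s]; last by rewrite big_map scaler_sumr.
by move=> w /mapP[w' /hs Sw' ->]; exact: SZ.
Qed.

Lemma sum_uniq_widen (I : eqType) (s t : seq I) (m : I -> V) :
  uniq s -> uniq t -> {subset s <= t} -> (forall i, i \notin s -> m i = 0) -> \sum_(i <- t) m i = \sum_(i <- s) m i.
Proof.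
move=> us ut st m0; rewrite (bigID (mem s)) /= [X in _ + X]big1 // addr0 -big_filter.
apply/perm_big/uniq_perm => [||i]; rewrite ?filter_uniq // mem_filter /=.
by case si: (i \in s); rewrite ?(st _ si).
Qed.

Lemma lspan_family (I : eqType) (D : I -> Prop) (Q : I -> V -> Prop) v :
  (forall i, subspace (Q i)) -> lspan (fun u => exists2 i, D i & Q i u) v ->
  exists (s : seq I) (m : I -> V),
    [/\ forall i, i \in s -> D i, forall i, Q i (m i) & v = \sum_(i <- s) m i].
Proof.
move=> sQ hv; suff [s [m [_ Ds Qm _ ->]]] : exists (s : seq I) (m : I -> V), [/\ uniq s,
    forall i, i \in s -> D i, forall i, Q i (m i), forall i, i \notin s -> m i = 0
    & v = \sum_(i <- s) m i] by exists s, m.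
move: v hv; apply: lspan_ind => [|u [i Di Qu]]; last first.
  exists [:: i], (fun j => if j == i then u else 0); split=> // [j|j|j|].
  - by rewrite inE => /eqP->.
  - by case: eqP => [->//|_]; case: (sQ j).
  - by rewrite inE => /negPf->.
  - by rewrite big_seq1 eqxx.
split=> [|u w [s [m [us Ds Qm m0 ->]]] [t [n [ut Dt Qn n0 ->]]]|a u [s [m [us Ds Qm m0 ->]]]].
- by exists [::], (fun=> 0); split=> // [i|]; [case: (sQ i)|rewrite big_nil].
- exists (undup (s ++ t)), (fun i => m i + n i); split=> [|i|i|i|].
  + exact: undup_uniq.
  + by rewrite mem_undup mem_cat => /orP[/Ds|/Dt].
  + by have [_ QD _] := sQ i; apply: QD.
  + by rewrite mem_undup mem_cat negb_or => /andP[/m0-> /n0->]; rewrite addr0.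
  + rewrite big_split /=; congr +%R; apply/esym/sum_uniq_widen; rewrite ?undup_uniq // => i hi;
    by rewrite mem_undup mem_cat hi ?orbT.
- exists s, (fun i => a *: m i); split=> // [i|i /m0->|]; rewrite ?scaler0 ?scaler_sumr //.
  by have [_ _ QZ] := sQ i; apply: QZ.
Qed.

End Subspaces.

Section LinearMaps.
Variables (F : fieldType) (V U : lmodType F) (f : {linear V -> U}).

Lemma subspace_preim (Q : U -> Prop) : subspace Q -> subspace (fun v => Q (f v)).
Proof.
move=> [Q0 QD QZ]; split=> [|u v|a u]; rewrite ?linear0 ?linearD ?linearZ //.
  exact: QD.
exact: QZ.
Qed.

Lemma lspan_map (S : V -> Prop) (S' : U -> Prop) v :
  (forall u, S u -> lspan S' (f u)) -> lspan S v -> lspan S' (f v).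
Proof. by move=> SS' /(_ _ (subspace_preim (lspan_subspace S'))); apply. Qed.

End LinearMaps.

Definition lin_fun (F : numClosedFieldType) (V U : lmodType F) (f : V -> U) (lf : lin f) :
  {linear V -> U} := HB.pack f (GRing.isLinear.Build F V U *:%R f lf).

Section Weights.
Variables (F : numClosedFieldType) (N : nat).
Implicit Types (z : tdual F N) (xi : tvec F N) (w x y : W N) (r : affine_root N).

Definition dual_pair z xi : F := \sum_j xi.1 j * z.1 j + xi.2 * z.2.
Definition root_pair z r : F := pair_root z r.1.1 r.1.2 r.2.

Lemma tdual_ext z z' : z.2 = z'.2 -> (forall j, z.1 j = z'.1 j) -> z = z'.
Proof. by case: z z' => [z c] [z' c'] /= -> h; congr pair; apply/ffunP. Qed.

Lemma wact_dualM x y z : wact_dual (wmul x y) z = wact_dual x (wact_dual y z).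
Proof. by apply: tdual_ext => // j; rewrite !ffunE /= invMg permM rmorphD /=; ring. Qed.

Lemma wact_dual1 z : wact_dual wone z = z.
Proof. by apply: tdual_ext => // j; rewrite !ffunE /= invg1 perm1 mulr0 addr0. Qed.

Lemma wact_dualK w : cancel (@wact_dual F N w) (wact_dual (winv w)).
Proof. by move=> z; rewrite -wact_dualM wmulVw wact_dual1. Qed.

Lemma wact_tM x y xi : wact_t (wmul x y) xi = wact_t x (wact_t y xi).
Proof.
apply: tdual_ext => [|j] /=; last by rewrite !ffunE /= invMg permM.
rewrite -!addrA -!opprD; congr (_ - _).
rewrite [X in _ = X + _](reindex_inj (@perm_inj _ (x.1^-1)%g)) /= -big_split /=.
by apply: eq_bigr => j _; rewrite !ffunE /= invMg permM rmorphD /=; ring.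
Qed.

Lemma wact_t1 xi : wact_t wone xi = xi.
Proof.
apply: tdual_ext => [|j] /=; last by rewrite !ffunE /= invg1 perm1.
by rewrite big1 ?subr0 // => j _; rewrite !ffunE mul0r.
Qed.

Lemma wact_tVK w : cancel (wact_t (winv w)) (@wact_t F N w).
Proof. by move=> xi; rewrite -wact_tM wmulwV wact_t1. Qed.

Lemma dual_pair_wact w z xi : dual_pair (wact_dual w z) (wact_t w xi) = dual_pair z xi.
Proof.
rewrite /dual_pair /= mulrBl addrCA -[RHS]addrC; congr +%R.
rewrite [RHS](reindex_inj (@perm_inj _ (w.1^-1)%g)) /= mulr_suml -sumrB.
by apply: eq_bigr => j _; rewrite !ffunE; ring.
Qed.

Lemma dual_pair_wactV w z xi : dual_pair (wact_dual w z) xi = dual_pair z (wact_t (winv w) xi).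
Proof. by rewrite -{1}(wact_tVK w xi) dual_pair_wact. Qed.

Lemma root_pair_wact w z r : root_pair (wact_dual w z) (wact_root w r) = root_pair z r.
Proof.
case: r => [[a b] k]; rewrite /root_pair /pair_root /wact_root /wroot /= !ffunE !permK !rmorphB /=.
ring.
Qed.

Lemma root_pair_wactV w z r : root_pair (wact_dual w z) r = root_pair z (wact_root (winv w) r).
Proof. by rewrite -{1}(wact_rootVK w r) root_pair_wact. Qed.

Lemma root_pair_opp z r : root_pair z (opp_root r) = - root_pair z r.
Proof. by case: r => [[a b] k]; rewrite /root_pair /pair_root /= rmorphN /=; ring. Qed.

Definition tbasis i : tvec F N := ([ffun j => (j == i)%:R], 0).

Lemma sum_delta (a : 'I_N) (g : 'I_N -> F) : \sum_j (j == a)%:R * g j = g a.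
Proof. by rewrite (bigD1 a) //= eqxx mul1r big1 ?addr0 // => j /negPf->; exact: mul0r. Qed.

Lemma dual_pair_tbasis z i : dual_pair z (tbasis i) = z.1 i.
Proof. by rewrite /dual_pair mul0r addr0 /=; under eq_bigr do rewrite ffunE; rewrite sum_delta. Qed.

Lemma coroot1 i j :
  (@coroot F N i).1 j = (j == (simple_root i).1.1)%:R - (j == (simple_root i).1.2)%:R.
Proof. by rewrite /coroot /simple_root; case: ifP => _; rewrite ffunE. Qed.

Lemma dual_pair_coroot z i : dual_pair z (coroot i) = root_pair z (simple_root i).
Proof.
rewrite /dual_pair; under eq_bigr do rewrite coroot1 mulrBl.
rewrite sumrB !sum_delta /root_pair /pair_root; congr (_ + _ * _).
by rewrite /coroot /simple_root; case: ifP.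
Qed.

Lemma alpha_of_sgen i xi : alpha_of i (wact_t (sgen i) xi) = - alpha_of i xi.
Proof.
rewrite /alpha_of /wact_t /sgen; case: ifP => /= i0.
  by rewrite !ffunE /= i0 !tpermV tpermL tpermR; ring.
by rewrite !ffunE /= i0 !tpermV tpermL tpermR; ring.
Qed.

Lemma actT_lin (V : lmodType F) (M : Hops F N V) xi :
  (forall i, lin (hX M i)) -> lin (hC M) -> lin (actT M xi).
Proof.
move=> lX lC a u v; rewrite /actT lC [xi.2 *: _]scalerDr [a *: (_ + _)]scalerDr addrACA.
congr +%R; last by rewrite !scalerA mulrC.
rewrite scaler_sumr -big_split /=.
by apply: eq_bigr => j _; rewrite lX scalerDr !scalerA mulrC.
Qed.

Hypothesis N2 : (2 <= N)%N.

Lemma wact_t_sgen1 i xi j :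
  (wact_t (sgen i) xi).1 j = xi.1 j - alpha_of i xi * (coroot i).1 j.
Proof.
have : is_root (simple_root i) by exact: simple_root_is_root.
rewrite coroot1 /is_root /alpha_of /simple_root /wact_t /sgen; case: ifP => i0 /= ne;
  rewrite ffunE tpermV.
- case: tpermP => [->|->|/eqP/negPf-> /eqP/negPf->]; rewrite ?eqxx; last by ring.
    by rewrite [_ == lasto i]eq_sym (negPf ne) /=; ring.
  by rewrite (negPf ne) /=; ring.
- case: tpermP => [->|->|/eqP/negPf-> /eqP/negPf->]; rewrite ?eqxx; last by ring.
    by rewrite (negPf ne) /=; ring.
  by rewrite [_ == prevo i]eq_sym (negPf ne) /=; ring.
Qed.

Lemma wact_t_sgen2 i xi : (wact_t (sgen i) xi).2 = xi.2 - alpha_of i xi * (coroot i).2.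
Proof.
rewrite /wact_t /sgen /coroot /alpha_of; case: ifP => i0 /=; last first.
  by rewrite mulr0 big1 // => j _; rewrite ffunE mul0r.
congr (_ - _); rewrite mulr1.
rewrite -(sum_delta (lasto i) xi.1) -(sum_delta (firsto i) xi.1) -sumrB.
rewrite [RHS](reindex_inj (@perm_inj _ (tperm (firsto i) (lasto i)))) /=.
apply: eq_bigr => j _; rewrite !ffunE /= tpermV -mulrBl rmorphB /= -!val_eqE /=.
have := tperm_val (firsto i) (lasto i) j => /=; move: (xi.1 _) (val (tperm _ _ j)) => c t.
have := ltn_ord j; rewrite /=.
by case: (val j =P 0%N); case: (val j =P N.-1); case: (t =P 0%N); case: (t =P N.-1) => //=; lia.
Qed.

Lemma dual_pair_sgen z i xi :
  dual_pair z (wact_t (sgen i) xi) = dual_pair z xi - alpha_of i xi * root_pair z (simple_root i).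
Proof.
rewrite -dual_pair_coroot /dual_pair wact_t_sgen2.
under eq_bigr do rewrite wact_t_sgen1 mulrBl -mulrA.
by rewrite sumrB -mulr_sumr; ring.
Qed.

Lemma actT_wact_sgen (V : lmodType F) (M : Hops F N V) i xi v :
  actT M (wact_t (sgen i) xi) v = actT M xi v - alpha_of i xi *: actT M (coroot i) v.
Proof.
rewrite /actT wact_t_sgen2; under eq_bigr do rewrite wact_t_sgen1 scalerBl -scalerA.
by rewrite sumrB -scaler_sumr scalerBl -scalerA addrACA -opprD -scalerDr.
Qed.

Lemma root_pair_sgen z i :
  root_pair (wact_dual (sgen i) z) (simple_root i) = - root_pair z (simple_root i).
Proof. by rewrite root_pair_wactV winv_sgen // wact_simple_root // root_pair_opp. Qed.

End Weights.

Section Modules.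
Variables (F : numClosedFieldType) (N : nat) (affine : bool).

(* [affine = true] gives the defining relations of H; [affine = false] keeps only those of the
   finite part, so that a module over \bar H on which c acts by a scalar also qualifies. *)
Definition hecke_axioms (V : lmodType F) (M : Hops F N V) : Prop :=
  [/\ (forall x, lin (hW M x)) /\ (forall i, lin (hX M i)) /\ lin (hC M),
      (forall v, hW M wone v = v) /\ (forall x y v, hW M (wmul x y) v = hW M x (hW M y v)),
      (forall i j v, hX M i (hX M j v) = hX M j (hX M i v)) /\
      (forall i v, hX M i (hC M v) = hC M (hX M i v)),
      (forall i xi v, simple_index affine i ->
         hW M (sgen i) (actT M xi v) - actT M (wact_t (sgen i) xi) (hW M (sgen i) v)
           = - alpha_of i xi *: v)
    & (affine -> forall xi v, hW M piW (actT M xi v) = actT M (wact_t piW xi) (hW M piW v))].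

Structure hecke_module (V : lmodType F) :=
  HeckeModule { hecke_ops :> Hops F N V; hecke_moduleP : hecke_axioms hecke_ops }.

Variable V : lmodType F.
Implicit Types (M : hecke_module V) (v : V) (xi : tvec F N) (z : tdual F N) (w x y : W N).

Fact hW_linear M x : lin (hW M x). Proof. by case: (hecke_moduleP M) => -[]. Qed.
HB.instance Definition _ M x :=
  GRing.isLinear.Build F V V *:%R (hW (hecke_ops M) x) (hW_linear M x).

Fact hX_linear M i : lin (hX M i). Proof. by case: (hecke_moduleP M) => -[_ []]. Qed.
HB.instance Definition _ M i :=
  GRing.isLinear.Build F V V *:%R (hX (hecke_ops M) i) (hX_linear M i).

Fact hC_linear M : lin (hC M). Proof. by case: (hecke_moduleP M) => -[_ []]. Qed.
HB.instance Definition _ M :=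
  GRing.isLinear.Build F V V *:%R (hC (hecke_ops M)) (hC_linear M).

Fact actT_linear M xi : lin (actT M xi).
Proof. by apply: actT_lin => [i|]; [exact: hX_linear|exact: hC_linear]. Qed.
HB.instance Definition _ M xi :=
  GRing.isLinear.Build F V V *:%R (actT (hecke_ops M) xi) (actT_linear M xi).

Fact phi_gen_linear M i : lin (phi_gen M i).
Proof. by move=> a u v; rewrite /phi_gen !linearP /= scalerDr addrACA. Qed.
HB.instance Definition _ M i :=
  GRing.isLinear.Build F V V *:%R (phi_gen (hecke_ops M) i) (phi_gen_linear M i).

Lemma hW1 M v : hW M wone v = v. Proof. by case: (hecke_moduleP M) => _ []. Qed.
Lemma hWM M x y v : hW M (wmul x y) v = hW M x (hW M y v).
Proof. by case: (hecke_moduleP M) => _ []. Qed.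
Lemma hX_comm M i j v : hX M i (hX M j v) = hX M j (hX M i v).
Proof. by case: (hecke_moduleP M) => _ _ []. Qed.

Lemma hWVK M x : cancel (hW M (winv x)) (hW M x).
Proof. by move=> v; rewrite -hWM wmulwV hW1. Qed.
Lemma hWK M x : cancel (hW M x) (hW M (winv x)).
Proof. by move=> v; rewrite -hWM wmulVw hW1. Qed.

Lemma actT_tbasis M i v : actT M (tbasis F i) v = hX M i v.
Proof.
rewrite /actT scale0r addr0 (bigD1 i) //= ffunE eqxx scale1r big1 ?addr0 // => j /negPf ji.
by rewrite ffunE ji scale0r.
Qed.

Definition weight_vec (M : Hops F N V) z v :=
  (forall i, hX M i v = z.1 i *: v) /\ hC M v = z.2 *: v.

Lemma weight_vecP M z v : weight_vec M z v <-> forall xi, actT M xi v = dual_pair z xi *: v.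
Proof.
split=> [[hx hc] xi|h].
  rewrite /actT /dual_pair scalerDl scaler_suml hc scalerA; congr +%R.
  by apply: eq_bigr => j _; rewrite hx scalerA.
split=> [i|]; first by rewrite -actT_tbasis h dual_pair_tbasis.
have := h ([ffun => 0], 1); rewrite /actT /dual_pair /=.
under eq_bigr do rewrite ffunE scale0r; under [in RHS]eq_bigr do rewrite ffunE mul0r.
by rewrite !big1 // !add0r scale1r mul1r.
Qed.

Lemma weight_vec_subspace M z : subspace (weight_vec M z).
Proof.
split=> [|u v /weight_vecP hu /weight_vecP hv|a u /weight_vecP hu]; apply/weight_vecP => xi.
- by rewrite linear0 scaler0.
- by rewrite linearD /= hu hv scalerDr.
- by rewrite linearZ /= hu !scalerA mulrC.
Qed.

Lemma weight_vecZ M z a v : weight_vec M z v -> weight_vec M z (a *: v).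
Proof. by case: (weight_vec_subspace M z) => _ _; apply. Qed.

Hypothesis N2 : (2 <= N)%N.

Lemma actT_sgen M i xi v : simple_index affine i ->
  actT M xi (hW M (sgen i) v) =
    hW M (sgen i) (actT M (wact_t (sgen i) xi) v) - alpha_of i xi *: v.
Proof.
move=> si; case: (hecke_moduleP M) => _ _ _ /(_ i (wact_t (sgen i) xi) v si) + _.
rewrite alpha_of_sgen opprK -wact_tM sgenK // wact_t1 => <-.
by rewrite opprB addrC subrK.
Qed.

Lemma hW_pi_actT M xi v : affine -> hW M piW (actT M xi v) = actT M (wact_t piW xi) (hW M piW v).
Proof. by case: (hecke_moduleP M) => _ _ _ _ h aff; apply: h. Qed.

Lemma hW_pow_actT M k xi v : rotation_index affine k ->
  hW M (wpowz piW k) (actT M xi v) = actT M (wact_t (wpowz piW k) xi) (hW M (wpowz piW k) v).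
Proof.
have iterE c n : (forall xi' v', hW M c (actT M xi' v') = actT M (wact_t c xi') (hW M c v')) ->
    hW M (iter n (wmul c) wone) (actT M xi v) =
    actT M (wact_t (iter n (wmul c) wone) xi) (hW M (iter n (wmul c) wone) v).
  move=> hc; elim: n => [|n IH] /=; first by rewrite !hW1 wact_t1.
  by rewrite !hWM IH hc wact_tM.
case/orP => [aff|/eqP->]; last by rewrite !hW1 wact_t1.
case: k => n; apply: iterE => xi' v'; first exact: hW_pi_actT.
by apply: (can_inj (hWK M piW)); rewrite hWVK hW_pi_actT // hWVK wact_tVK.
Qed.

Lemma weight_vec_pow M k z v : rotation_index affine k ->
  weight_vec M (wact_dual (wpowz piW k) z) (hW M (wpowz piW k) v) <-> weight_vec M z v.
Proof.
move=> rk; rewrite !weight_vecP; split=> hv xi.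
  apply: (can_inj (hWK M (wpowz piW k))).
  by rewrite hW_pow_actT // hv dual_pair_wact linearZ.
by rewrite -(wact_tVK (wpowz piW k) xi) -hW_pow_actT // hv linearZ /= dual_pair_wact.
Qed.

Lemma phi_weight M z i v : weight_vec M z v ->
  phi_gen M i v = v + root_pair z (simple_root i) *: hW M (sgen i) v.
Proof. by move=> /weight_vecP hv; rewrite /phi_gen hv dual_pair_coroot linearZ. Qed.

Lemma weight_vec_phi M z i v : simple_index affine i -> weight_vec M z v ->
  weight_vec M (wact_dual (sgen i) z) (phi_gen M i v).
Proof.
move=> si hv; rewrite (phi_weight i hv); move/weight_vecP: hv => hv; apply/weight_vecP => xi.
rewrite linearD linearZ /= actT_sgen // !hv linearZ /= dual_pair_wactV winv_sgen //.
rewrite scalerBr addrCA [RHS]scalerDr [RHS]addrC; congr +%R; first by rewrite !scalerA mulrC.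
by rewrite scalerA -scalerBl dual_pair_sgen // mulrC.
Qed.

Lemma phi_phi M z i v : simple_index affine i -> weight_vec M z v ->
  phi_gen M i (phi_gen M i v) = (1 - root_pair z (simple_root i) ^+ 2) *: v.
Proof.
move=> si hv; rewrite (phi_weight i (weight_vec_phi si hv)) (phi_weight i hv) root_pair_sgen //.
rewrite linearD linearZ /= -hWM sgenK // hW1 scaleNr scalerDr opprD scalerA addrA addrK.
by rewrite scalerBl scale1r -expr2.
Qed.

Lemma one_sub_sqr_neq0 (c : F) : c != 1 -> c != -1 -> 1 - c ^+ 2 != 0.
Proof. by move=> c1 cm1; rewrite subr_eq0 eq_sym sqrf_eq1 negb_or c1. Qed.

Definition hX_prod M (L : seq ('I_N * F)) v : V := foldr (fun p u => hX M p.1 u - p.2 *: u) v L.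

Fact hX_prod_linear M L : lin (hX_prod M L).
Proof.
elim: L => [|p L IH] a u v //=; rewrite IH linearP scalerDr scalerBr !scalerA [p.2 * a]mulrC.
by rewrite opprD addrACA.
Qed.
HB.instance Definition _ M L := GRing.isLinear.Build F V V *:%R (hX_prod M L) (hX_prod_linear M L).

(* On the vectors of weight [zb] the operator [hX_prod L] is an invertible scalar. *)
Definition localized M (zb : {ffun 'I_N -> F}) (D : V -> Prop) v :=
  exists2 L, all (fun p => zb p.1 != p.2) L & D (hX_prod M L v).

Section Localization.
Variables (M : hecke_module V) (zb : {ffun 'I_N -> F}) (D : V -> Prop).
Hypotheses (sD : subspace D) (DX : forall i v, D v -> D (hX M i v)).
Implicit Types L : seq ('I_N * F).

Lemma hX_prod_cat L L' v : hX_prod M (L ++ L') v = hX_prod M L (hX_prod M L' v).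
Proof. by rewrite /hX_prod foldr_cat. Qed.

Lemma hX_prod_comm L L' v : hX_prod M L (hX_prod M L' v) = hX_prod M L' (hX_prod M L v).
Proof.
have prod_hX i u : hX_prod M L' (hX M i u) = hX M i (hX_prod M L' u).
  by elim: L' => //= p L' ->; rewrite hX_comm [RHS]linearB /= [hX M i (_ *: _)]linearZ.
by elim: L => //= p L IH; rewrite IH [RHS]linearB /= [hX_prod M L' (_ *: _)]linearZ prod_hX.
Qed.

Lemma hX_prod_stable L v : D v -> D (hX_prod M L v).
Proof.
move=> Dv; elim: L => //= p L IH; apply: subspaceB => //; first exact: DX.
by case: sD => _ _; apply.
Qed.

Lemma localized_subspace : subspace (localized M zb D).
Proof.
have [D0 DD DZ] := sD; split=> [|u v [L gL hL] [L' gL' hL']|a u [L gL hL]].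
- by exists [::].
- exists (L ++ L'); first by rewrite all_cat gL.
  rewrite hX_prod_cat !linearD /=; apply: DD; last exact: hX_prod_stable.
  by rewrite hX_prod_comm; apply: hX_prod_stable.
- by exists L => //; rewrite linearZ; apply: DZ.
Qed.

Lemma localized_base v : D v -> localized M zb D v.
Proof. by exists [::]. Qed.

Lemma localized_step i c v : zb i != c -> localized M zb D (hX M i v - c *: v) ->
  localized M zb D v.
Proof.
move=> zc [L gL hL]; exists (L ++ [:: (i, c)]); last by rewrite hX_prod_cat.
by rewrite all_cat gL /= zc.
Qed.

Lemma hX_prod_weight z L v : weight_vec M z v ->
  hX_prod M L v = (\prod_(p <- L) (z.1 p.1 - p.2)) *: v.
Proof.
move=> [hX _]; elim: L => [|p L IH]; first by rewrite big_nil scale1r.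
by rewrite /= IH big_cons linearZ /= hX !scalerA -scalerBl mulrBl [_ * z.1 _]mulrC.
Qed.

Lemma localized_weight z v : z.1 = zb -> weight_vec M z v -> localized M zb D v -> D v.
Proof.
move=> zE hv [L gL]; rewrite (hX_prod_weight _ hv); apply: subspace_unscale => //.
rewrite prodf_seq_neq0; apply: sub_all gL => p /=.
by rewrite zE subr_eq0.
Qed.

End Localization.

(* Subtracting its eigenvalue on one summand removes that summand and keeps the others weight
   vectors, so the number of summands can be decreased until a single weight remains. *)
Lemma weight_vec_in_stable M (c : F) (Z : tdual F N -> Prop) (Q : V -> Prop) (s : seq V) :
  subspace Q -> (forall i v, Q v -> Q (hX M i v)) ->
  (forall u, u \in s -> exists2 z, Z z /\ z.2 = c & weight_vec M z u) ->
  Q (\sum_(u <- s) u) -> \sum_(u <- s) u <> 0 ->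
  exists z u, [/\ Z z, weight_vec M z u, Q u & u <> 0].
Proof.
move=> sQ QX; have [n] := ubnP (size s); elim: n s => // n IH [|u0 s] /= hn hs.
  by rewrite big_nil.
set q := \sum_(u <- _) _ => Qq q0.
have [z [Zz zc] wu0] := hs u0 (mem_head _ _).
have hCq : hC M q = c *: q.
  rewrite /q linear_sum scaler_sumr big_seq [RHS]big_seq; apply: eq_bigr => u /hs[z' [_ <-] wu].
  by case: wu.
have [/forallP hall|/forallPn[i hi]] := boolP [forall i, hX M i q - z.1 i *: q == 0].
  exists z, q; split=> //; split=> [i|]; last by rewrite zc.
  by apply/eqP; rewrite -subr_eq0.
pose g u := hX M i u - z.1 i *: u.
have gE : g q = \sum_(u <- [seq g u | u <- s]) u.
  rewrite big_map /g /q linear_sum scaler_sumr -sumrB big_cons /= (wu0.1 i).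
  by rewrite subrr add0r.
apply: (IH [seq g u | u <- s]); rewrite ?size_map -?gE //; last exact/eqP.
  move=> u /mapP[u' us' ->]; have [z' Zz' wu'] := hs u' (mem_behead (s := u0 :: s) us').
  by exists z' => //; rewrite /g (wu'.1 i) -scalerBl; apply: weight_vecZ.
by apply: subspaceB => //; [exact: QX|case: sQ => _ _; apply].
Qed.

Definition weight_span M (Z : tdual F N -> Prop) :=
  lspan (fun u => exists2 z, Z z & weight_vec M z u).

Lemma weight_span_stable M Z i v : weight_span M Z v -> weight_span M Z (hX M i v).
Proof.
apply: lspan_map => u [z Zz wu] /=; rewrite (wu.1 i).
by apply: mem_lspan; exists z => //; apply: weight_vecZ.
Qed.

Lemma weight_span_disjoint M c (Z Z' : tdual F N -> Prop) v :
  (forall z, Z z -> z.2 = c) -> (forall z z', Z z -> Z' z' -> z'.1 <> z.1) ->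
  weight_span M Z v -> weight_span M Z' v -> v = 0.
Proof.
move=> Zc ZZ' Zv Z'v; apply/eqP/idPn => /eqP v0.
have [a u [z Zz wu]|s hs vE] := lspan_seq _ Zv; first by exists z => //; exact: weight_vecZ.
rewrite {}vE in v0 Z'v.
have [u us|z [u [Zz wu Z'u u0]]] := weight_vec_in_stable (c := c) (Z := Z)
    (lspan_subspace _) (@weight_span_stable M Z') _ Z'v v0.
  by have [z Zz wu] := hs u us; exists z => //; split=> //; exact: Zc.
have DX i (x : V) : x = 0 -> hX M i x = 0 by move=> ->; exact: linear0.
apply: u0; apply: (localized_weight (subspace0 V) (erefl z.1) wu).
apply: lspan_ind Z'u => [|u' [z' Zz' wu']]; first exact: localized_subspace (subspace0 V) DX.
have /existsP[i hi] : [exists i, z.1 i != z'.1 i].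
  apply/existsPn => h; apply: (ZZ' z z' Zz Zz'); apply/ffunP => i.
  by apply/esym/eqP; rewrite -[_ == _]negbK h.
by apply: (localized_step hi); apply: localized_base; rewrite (wu'.1 i) subrr.
Qed.

End Modules.

(** * Cyclic modules of generic weight *)

Section GenericWeights.
Variables (F : numClosedFieldType) (N : nat) (affine : bool) (sel : 'I_N -> bool).
Variable z : tdual F N.
Implicit Types (w : W N) (i j a b : 'I_N) (r : affine_root N).
Local Notation ht := (block_height sel).

Definition nonresonant (c : F) := [&& c != 1, c != 0 & c != -1].

Lemma nonresonantN c : nonresonant (- c) = nonresonant c.
Proof. by rewrite /nonresonant oppr_eq0 eqr_opp eqr_oppLR andbC -andbA andbCA. Qed.

Definition block_generic := forall r, in_roots affine r -> is_root r -> 0 < ht r ->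
  nonresonant (root_pair z r).

Hypothesis zblock : in_tdual_gamma sel z.

Lemma root_pair_block r : is_root r -> ht r = 0 -> root_pair z r = (r.1.1)%:R - (r.1.2)%:R.
Proof.
case: r => [[a b] k]; rewrite /is_root => ir /eqP; rewrite block_height_eq0 //=.
move=> /andP[/eqP-> cab]; have sab : sameblk sel a b by rewrite sameblkE.
rewrite /root_pair /pair_root mul0r addr0 /=.
wlog ab : a b ir cab sab / (a < b)%N => [h|].
  case: (ltngtP a b) ir => [ab|ba|/val_inj->] ir; [exact: h| |by rewrite eqxx in ir].
  by rewrite -[LHS]opprB -[RHS]opprB (h b a) // ?sameblkE 1?eq_sym.
have : z.1 a - a%:R = z.1 b - b%:R.
  apply: (sameblk_homo (R := eq) (f := fun j => z.1 j - j%:R)) ab sab => [y p q -> //|i i0 si].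
  rewrite (canRL (subrK _) (zblock i0 si)) (_ : i%:R = (prevo i)%:R + 1); first by ring.
  by rewrite natr1 /= prednK // lt0n.
by move=> h; rewrite -[z.1 a](subrK a%:R) h; ring.
Qed.

Hypothesis zgen : block_generic.

Lemma root_pair_nonresonant r : in_roots affine r -> is_root r -> ht r != 0 ->
  nonresonant (root_pair z r).
Proof.
move=> sr ir; case: (ltgtP 0 (ht r)) => // h _; first exact: zgen.
rewrite -nonresonantN -root_pair_opp; apply: zgen; rewrite ?in_roots_opp ?is_root_opp //.
by rewrite block_height_opp oppr_gt0.
Qed.

Lemma root_pair_neq0 r : in_roots affine r -> is_root r -> root_pair z r != 0.
Proof.
move=> sr ir; have [h0|h] := eqVneq (ht r) 0; last first.
  by have /and3P[] := root_pair_nonresonant sr ir h.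
by rewrite root_pair_block // subr_eq0 eqr_nat.
Qed.

Hypothesis zc : affine -> z.2 != 0.

Lemma wact_dual_stab w : in_weyl affine w -> (wact_dual w z).1 = z.1 -> w = wone.
Proof.
move=> sw e; have ej j : z.1 j + z.2 * (w.2 (w.1 j))%:~R = z.1 (w.1 j).
  by rewrite -[in RHS]e ffunE permK.
have w1 : w.1 = 1%g.
  apply/permP => j; rewrite perm1; apply/eqP/idPn => ne.
  have /negP[] : root_pair z (j, w.1 j, w.2 (w.1 j)) != 0.
    apply: root_pair_neq0; last by rewrite /is_root /= eq_sym.
    by move: sw; rewrite /in_roots /in_weyl => /orP[->//|/eqP ->]; rewrite ffunE eqxx orbT.
  by rewrite /root_pair /pair_root /= -ej; apply/eqP; ring.
apply: W_ext => // j; rewrite ffunE; move: sw; rewrite /in_weyl.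
move=> /orP[aff|/eqP->]; last by rewrite ffunE.
have /eqP := ej j; rewrite w1 perm1 -subr_eq0 addrAC subrr add0r.
by rewrite mulf_eq0 (negPf (zc aff)) intr_eq0 => /eqP.
Qed.

Lemma wact_dual_inj w w' : in_weyl affine w -> in_weyl affine w' ->
  (wact_dual w z).1 = (wact_dual w' z).1 -> w = w'.
Proof.
move=> sw sw' e; apply/esym/wmul_eq1/wact_dual_stab.
  by apply: in_weylM => //; exact: in_weylV.
rewrite wact_dualM; have -> : wact_dual w z = wact_dual w' z by apply: tdual_ext => // j; rewrite e.
by rewrite wact_dualK.
Qed.

End GenericWeights.

Section CyclicModules.
Variables (F : numClosedFieldType) (N : nat) (affine : bool) (sel : 'I_N -> bool).
Variable z : tdual F N.
Hypotheses (N2 : (2 <= N)%N) (zblock : in_tdual_gamma sel z) (zgen : block_generic affine sel z)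
  (zc : affine -> z.2 != 0).
Variables (V : lmodType F) (M : hecke_module N affine V) (one : V).
Hypothesis rel1 : relH sel z M one.
Implicit Types (w : W N) (i : 'I_N) (u v : V) (Q : V -> Prop).

Local Notation wz w := (wact_dual w z).
Local Notation ht := (block_height sel).
Local Notation in_weyl := (in_weyl affine).

Definition orbit_span := lspan (fun u => exists2 w, in_weyl w & u = hW M w one).

Lemma orbit_span_subspace : subspace orbit_span.
Proof. exact: lspan_subspace. Qed.

Definition span_below n :=
  lspan (fun u => exists2 w, in_weyl w && (wlength w < n)%N & u = hW M w one).

Lemma weight_vec_one : weight_vec M z one.
Proof. by case: rel1. Qed.

Lemma actT_triangular w : in_weyl w -> forall xi,
  span_below (wlength w) (actT M xi (hW M w one) - dual_pair (wz w) xi *: hW M w one).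
Proof.
have sB n := lspan_subspace (fun u => exists2 w, in_weyl w && (wlength w < n)%N & u = hW M w one).
move: w; apply: (weyl_ind N2) => [k rk|i w si sw lt IH] xi.
  have /(weight_vec_pow M _ _ rk)/weight_vecP-> := weight_vec_one.
  by rewrite subrr; case: (sB (wlength (wpowz (@piW N) k))).
rewrite !hWM actT_sgen // wact_dualM dual_pair_wactV winv_sgen // addrAC -linearZ -linearB /=.
apply: (subspaceB (sB _)); last first.
  have [_ _ SZ] := sB (wlength (wmul (sgen i) w)).
  by apply: SZ; apply: mem_lspan; exists w; rewrite // sw.
apply: lspan_map (IH (wact_t (sgen i) xi)) => _ [y /andP[sy ly] ->].
apply: mem_lspan; exists (wmul (sgen i) y); last by rewrite hWM.
rewrite in_weylM ?in_weyl_sgen //=; apply: leq_ltn_trans (wlength_sgen_le N2 i y) _.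
exact: leq_trans lt.
Qed.

Lemma orbit_span_one : orbit_span one.
Proof. by apply: mem_lspan; exists wone; rewrite ?in_weyl1 ?hW1. Qed.

Lemma orbit_span_hW w v : in_weyl w -> orbit_span v -> orbit_span (hW M w v).
Proof.
move=> sw; apply: lspan_map => _ [y sy ->] /=.
by apply: mem_lspan; exists (wmul w y); [exact: in_weylM|rewrite hWM].
Qed.

Lemma orbit_span_actT xi v : orbit_span v -> orbit_span (actT M xi v).
Proof.
apply: lspan_map => _ [w sw ->] /=.
rewrite -[actT _ _ _](subrK (dual_pair (wz w) xi *: hW M w one)).
have [_ SD SZ] := orbit_span_subspace; apply: SD; last by apply: SZ; apply: mem_lspan; exists w.
apply: lspan_ind (actT_triangular sw xi) => [|_ [y /andP[sy _] ->]]; first exact: lspan_subspace.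
by apply: mem_lspan; exists y.
Qed.

Lemma orbit_span_hX i v : orbit_span v -> orbit_span (hX M i v).
Proof. by rewrite -actT_tbasis; exact: orbit_span_actT. Qed.

Lemma orbit_span_phi i v : simple_index affine i -> orbit_span v -> orbit_span (phi_gen M i v).
Proof.
move=> si hv; have [_ SD _] := orbit_span_subspace; apply: SD => //.
by apply: orbit_span_hW; [exact: in_weyl_sgen|exact: orbit_span_actT].
Qed.

Definition orbit_weight w v := weight_vec M (wz w) v /\ orbit_span v.

Lemma orbit_weight_one : orbit_weight wone one.
Proof. by split; [rewrite wact_dual1; exact: weight_vec_one|exact: orbit_span_one]. Qed.

Lemma orbit_weight_subspace w : subspace (orbit_weight w).
Proof. by apply: subspaceI; [exact: weight_vec_subspace|exact: orbit_span_subspace]. Qed.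

Lemma orbit_weight_phi i w v : simple_index affine i -> orbit_weight w v ->
  orbit_weight (wmul (sgen i) w) (phi_gen M i v).
Proof.
move=> si [wv hv]; split; last exact: orbit_span_phi.
by rewrite wact_dualM; exact: weight_vec_phi.
Qed.

Lemma orbit_weight_pow k w v : rotation_index affine k -> orbit_weight w v ->
  orbit_weight (wmul (wpowz piW k) w) (hW M (wpowz piW k) v).
Proof.
move=> rk [wv hv]; split; first by rewrite wact_dualM; apply/weight_vec_pow.
by apply: orbit_span_hW => //; exact: in_weyl_pow.
Qed.

Lemma in_roots_preimage i w : simple_index affine i -> in_weyl w ->
  in_roots affine (wact_root (winv w) (simple_root i)).
Proof. by move=> si sw; apply: in_roots_wact; [exact: in_weylV|exact: in_roots_simple]. Qed.

Lemma is_root_preimage i w : is_root (wact_root (winv w) (simple_root i)).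
Proof. by rewrite is_root_wact simple_root_is_root. Qed.

Lemma orbit_span_localized (zb : {ffun 'I_N -> F}) (D : V -> Prop) :
  subspace D -> (forall i v, D v -> D (hX M i v)) ->
  (forall w, in_weyl w -> min_rep sel w -> (wz w).1 = zb -> D (hW M w one)) ->
  forall v, orbit_span v -> localized M zb D v.
Proof.
move=> sD DX Dzb; have sL := localized_subspace zb sD DX.
apply: lspan_ind => // _ [w sw ->]; have [n] := ubnP (wlength w); elim: n w sw => // n IH w sw ln.
have [mw|/min_repPn[p [p0 sp np]]] := boolP (min_rep sel w); last first.
  have -> : hW M w one = hW M (wmul w (sgen p)) one.
    by rewrite hWM; case: rel1 => h _ _; rewrite (h (sgen p)) //; exact: in_Wbar_sgen.
  apply: IH; last exact: leq_trans (wlength_mulr_lt N2 np) ln.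
  by apply: in_weylM => //; apply: in_weyl_sgen; rewrite /simple_index p0 orbT.
have [/Dzb Dw|nz] := eqVneq (wz w).1 zb; first by apply: localized_base; exact: Dw.
have /existsP[i hi] : [exists i, zb i != (wz w).1 i].
  by apply: contraNT nz => /existsPn h; apply/eqP/ffunP => i; have /negPn/eqP-> := h i.
apply: (localized_step hi).
have := actT_triangular sw (tbasis F i); rewrite actT_tbasis dual_pair_tbasis.
by apply: lspan_ind => // _ [y /andP[sy ly] ->]; apply: IH => //; exact: leq_trans ly ln.
Qed.

Lemma orbit_weight_min_rep w v : in_weyl w -> orbit_weight w v -> v <> 0 -> min_rep sel w.
Proof.
move=> sw [wv hv] v0; apply/idPn => nm; apply: v0.
have DX i (u : V) : u = 0 -> hX M i u = 0 by move=> ->; exact: linear0.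
apply: (localized_weight (subspace0 V) (erefl (wz w).1) wv).
apply: (orbit_span_localized (subspace0 V) DX) hv => y sy my e.
by rewrite (wact_dual_inj zblock zgen zc sy sw e) (negPf nm) in my.
Qed.

Lemma orbit_weight1 v : orbit_weight wone v -> exists c, v = c *: one.
Proof.
move=> [wv hv]; have DX i (u : V) : (exists c, u = c *: one) -> exists c, hX M i u = c *: one.
  by move=> [c ->]; exists (c * z.1 i); rewrite linearZ /= weight_vec_one.1 scalerA.
apply: (localized_weight (subspace_line one) (erefl _) wv).
apply: (orbit_span_localized (subspace_line one) DX) hv => y sy _ e.
by exists 1; rewrite (wact_dual_inj zblock zgen zc sy (in_weyl1 _ _) e) hW1 scale1r.
Qed.

Lemma phi_phi_min_rep i w v : simple_index affine i -> in_weyl w -> min_rep sel w ->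
  ht (wact_root (winv w) (simple_root i)) != 0 -> orbit_weight w v ->
  exists2 c, c != 0 & phi_gen M i (phi_gen M i v) = c *: v.
Proof.
move=> si sw mw h [wv _]; rewrite (phi_phi N2 si wv) root_pair_wactV; eexists; last by [].
have /and3P[n1 _ nm1] :=
  root_pair_nonresonant zgen (in_roots_preimage si sw) (is_root_preimage i w) h.
exact: one_sub_sqr_neq0.
Qed.

Definition stable Q := [/\ subspace Q, forall i v, Q v -> Q (hX M i v)
  & forall w v, in_weyl w -> Q v -> Q (hW M w v)].

Lemma stable_phi Q x i v : stable Q -> simple_index affine i -> weight_vec M x v -> Q v ->
  Q (phi_gen M i v).
Proof.
move=> [[_ QD QZ] _ QW] si wv Qv; rewrite (phi_weight i wv).
by apply: QD => //; apply/QZ/QW => //; exact: in_weyl_sgen.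
Qed.

Lemma intertwiner_to_one w : in_weyl w -> min_rep sel w -> exists T : {linear V -> V},
  forall v, orbit_weight w v ->
    [/\ orbit_weight wone (T v), T v = 0 -> v = 0 & forall Q, stable Q -> Q v -> Q (T v)].
Proof.
move: w; apply: (min_rep_ind N2) => [k rk|i w si sw mw h [T hT]].
  exists (hW M (winv (wpowz piW k))) => v [wv hv]; split.
  - split; last by apply: orbit_span_hW => //; apply/in_weylV/in_weyl_pow.
    by rewrite wact_dual1; apply/(weight_vec_pow M _ _ rk); rewrite hWVK.
  - by move/(congr1 (hW M (wpowz piW k))); rewrite hWVK linear0.
  - by move=> Q [_ _ QW] Qv; apply: QW => //; apply/in_weylV/in_weyl_pow.
exists (T \o phi_gen M i) => v wv /=; have := orbit_weight_phi si wv; rewrite wmulsK // => wpv.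
have [w1 T0 TQ] := hT _ wpv; split=> [//|/T0 pv0|Q sQ Qv]; last first.
  by apply: TQ => //; apply: stable_phi wv.1 Qv.
have msw : min_rep sel (wmul (sgen i) w) by rewrite min_rep_sgen // gt_eqF.
have [||c c0 e] := phi_phi_min_rep si _ msw _ wv.
- by apply: in_weylM => //; exact: in_weyl_sgen.
- by rewrite wact_rootV_sgen // block_height_opp oppr_eq0 gt_eqF.
by apply/eqP; move/eqP: e; rewrite pv0 linear0 eq_sym scaler_eq0 (negPf c0).
Qed.

Lemma orbit_weight_line w u v : in_weyl w -> orbit_weight w u -> orbit_weight w v -> u <> 0 ->
  exists c, v = c *: u.
Proof.
move=> sw wu wv u0; have [T hT] := intertwiner_to_one sw (orbit_weight_min_rep sw wu u0).
have [/orbit_weight1[a aE] Tu0 _] := hT u wu; have [/orbit_weight1[b bE] _ _] := hT v wv.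
have a0 : a != 0 by apply/eqP => a0; apply/u0/Tu0; rewrite aE a0 scale0r.
exists (b / a); apply/eqP; rewrite -subr_eq0; apply/eqP.
have [|_ T0 _] := hT (v - (b / a) *: u).
  have sW := orbit_weight_subspace w; apply: (subspaceB sW) => //.
  by case: sW => _ _; apply.
by apply: T0; rewrite linearB linearZ /= aE bE scalerA divfK // subrr.
Qed.

Lemma orbit_weight_generates w v Q : in_weyl w -> orbit_weight w v -> v <> 0 -> stable Q -> Q v ->
  Q one.
Proof.
move=> sw wv v0 sQ Qv; have [T hT] := intertwiner_to_one sw (orbit_weight_min_rep sw wv v0).
have [/orbit_weight1[a aE] T0 /(_ Q sQ Qv)] := hT v wv; rewrite aE; apply: subspace_unscale.
  by case: sQ.
by apply/eqP => a0; apply/v0/T0; rewrite aE a0 scale0r.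
Qed.

Lemma orbit_span_weights v : orbit_span v ->
  lspan (fun u => exists2 w, in_weyl w & orbit_weight w u) v.
Proof.
set S := fun u => _; have sS := lspan_subspace S.
apply: lspan_ind => // _ [w sw ->]; move: w sw; apply: (weyl_ind N2) => [k rk|i w si sw _ IH].
  apply: mem_lspan; exists (wpowz piW k); first exact: in_weyl_pow.
  by rewrite -[X in orbit_weight X]wmulw1; apply: orbit_weight_pow orbit_weight_one.
rewrite hWM; apply: lspan_map IH => u [{sw}w sw wu] /=.
have c0 : root_pair (wz w) (simple_root i) != 0.
  rewrite root_pair_wactV; apply: (root_pair_neq0 zblock zgen); first exact: in_roots_preimage.
  exact: is_root_preimage.
apply: (subspace_unscale sS c0).
have -> : root_pair (wz w) (simple_root i) *: hW M (sgen i) u = phi_gen M i u - u.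
  by rewrite (phi_weight i wu.1) addrC addKr.
apply: (subspaceB sS); apply: mem_lspan; last by exists w.
exists (wmul (sgen i) w); last exact: orbit_weight_phi.
by apply: in_weylM => //; exact: in_weyl_sgen.
Qed.

Lemma orbit_span_hC v : orbit_span v -> hC M v = z.2 *: v.
Proof.
move=> /orbit_span_weights; move: v; apply: lspan_ind => [|u [w _ [[_ hCu] _]] //].
split=> [|u v hu hv|a u hu]; first by rewrite linear0 scaler0.
  by rewrite [LHS]linearD /= hu hv scalerDr.
by rewrite [LHS]linearZ /= hu !scalerA mulrC.
Qed.

Lemma stable_contains_one Q q : stable Q -> orbit_span q -> Q q -> q <> 0 -> Q one.
Proof.
move=> sQ hq Qq q0; have [ssQ QX _] := sQ.
have [a u [w sw wu]|s hs qE] := lspan_seq _ (orbit_span_weights hq).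
  by exists w => //; case: (orbit_weight_subspace w) => _ _; apply.
have sR := subspaceI ssQ orbit_span_subspace.
have RX i v : Q v /\ orbit_span v -> Q (hX M i v) /\ orbit_span (hX M i v).
  by move=> [Qv hv]; split; [exact: QX|exact: orbit_span_hX].
have weights u : u \in s -> exists2 y, (exists2 w, in_weyl w & y = wz w) /\ y.2 = z.2
    & weight_vec M y u.
  by move=> /hs[w sw [wu _]]; exists (wz w); first by split; [exists w|].
have Rq : Q q /\ orbit_span q by []; rewrite qE in Rq q0.
have [_ [u [[w sw ->] wu [Qu hu] u0]]] := weight_vec_in_stable sR RX weights Rq q0.
exact: (orbit_weight_generates sw (conj wu hu) u0 sQ Qu).
Qed.

Lemma phi_eq0 i w v : simple_index affine i -> in_weyl w -> min_rep sel w ->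
  ht (wact_root (winv w) (simple_root i)) = 0 -> orbit_weight w v -> phi_gen M i v = 0.
Proof.
move=> si sw mw h0 wv; apply/eqP/idPn => /eqP pv0.
have : min_rep sel (wmul (sgen i) w).
  apply: orbit_weight_min_rep (orbit_weight_phi si wv) pv0.
  by apply: in_weylM => //; exact: in_weyl_sgen.
by rewrite min_rep_sgen // h0 eqxx.
Qed.

Lemma phi_word_weight (js : seq 'I_N) : all (simple_index affine) js ->
  {in word_roots js, forall r, 0 < ht r} ->
  [/\ in_weyl (wword js), min_rep sel (wword js),
      orbit_weight (wword js) (foldr (phi_gen M) one js)
    & one <> 0 -> foldr (phi_gen M) one js <> 0].
Proof.
elim: js => [|i js IH] /=.
  move=> _ _; split=> //; first exact: in_weyl1.
    exact: (min_rep_pow sel N2 0).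
  exact: orbit_weight_one.
move=> /andP[si /IH{}IH] h; have hi := h _ (mem_head _ _).
have [r rj|sw mw wv v0] := IH; first by apply: h; rewrite inE rj orbT.
split; last 2 first.
- exact: orbit_weight_phi.
- move=> /v0 {}v0 pv0; apply: v0; have [|c c0] := phi_phi_min_rep si sw mw _ wv.
    by rewrite gt_eqF.
  by rewrite pv0 linear0 => /esym/eqP; rewrite scaler_eq0 (negPf c0) => /eqP.
- by apply: in_weylM => //; exact: in_weyl_sgen.
- by rewrite min_rep_sgen // gt_eqF.
Qed.

End CyclicModules.

(** * A module in which the cyclic vector is nonzero *)

Section FreeModules.
Variable F : fieldType.

Record free_module (K : Type) := FreeModule {
  free_sort :> lmodType F;
  free_basis : K -> free_sort;
  free_lift : forall T : lmodType F, (K -> T) -> {linear free_sort -> T};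
  free_liftE : forall (T : lmodType F) (g : K -> T) k, free_lift g (free_basis k) = g k;
  free_ext : forall (T : lmodType F) (f g : {linear free_sort -> T}),
    (forall k, f (free_basis k) = g (free_basis k)) -> f =1 g }.

Variable K : choiceType.
Implicit Types (p q : {malg F[K]}) (k : K).

Definition malg_lift (T : lmodType F) (g : K -> T) p : T := \sum_(k <- msupp p) p@_k *: g k.

Lemma malg_lift_widen (T : lmodType F) (g : K -> T) (d : {fset K}) p : (msupp p `<=` d)%fset ->
  malg_lift g p = \sum_(k <- d) p@_k *: g k.
Proof.
move=> le; rewrite /malg_lift; apply: big_fset_incl => // k _ kp.
by rewrite (mcoeff_outdom kp) scale0r.
Qed.

Fact malg_lift_linear (T : lmodType F) (g : K -> T) : linear (malg_lift g).
Proof.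
move=> a p q; pose d := (msupp p `|` msupp q `|` msupp (a *: p + q)%R)%fset.
rewrite !(@malg_lift_widen _ g d); try by apply/fsubsetP => k kp; rewrite !in_fsetU kp ?orbT.
rewrite scaler_sumr -big_split /=; apply: eq_bigr => k _.
by rewrite mcoeffD mcoeffZ scalerDl scalerA.
Qed.
HB.instance Definition _ (T : lmodType F) (g : K -> T) :=
  GRing.isLinear.Build F {malg F[K]} T *:%R (malg_lift g) (malg_lift_linear g).

Lemma malg_liftE (T : lmodType F) (g : K -> T) k : malg_lift g << k >> = g k.
Proof. by rewrite (malg_lift_widen g msuppU_le) big_seq_fset1 mcoeffUU scale1r. Qed.

Lemma malg_ext (T : lmodType F) (f g : {linear {malg F[K]} -> T}) :
  (forall k, f << k >> = g << k >>) -> f =1 g.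
Proof.
move=> fg p; rewrite [p]monalgE !linear_sum; apply: eq_bigr => k _.
have -> : << p@_k *g k >> = p@_k *: << k >>.
  by apply/malgP => k'; rewrite mcoeffZ !mcoeffU; case: eqP; rewrite ?mulr1 ?mulr0.
by rewrite !linearZ /= fg.
Qed.

Definition malg_free_module : free_module K :=
  FreeModule (fun T g k => malg_liftE g k) malg_ext.

End FreeModules.

Section Reflections.
Variables (F : numClosedFieldType) (N : nat).
Implicit Types (w x y : W N) (r : affine_root N) (xi : tvec F N).

Definition root_refl r : W N :=
  (tperm r.1.1 r.1.2, [ffun j => - r.2 * ((j == r.1.1)%:R - (j == r.1.2)%:R)]).

Lemma root_refl_conj w r : is_root r ->
  wmul w (root_refl r) = wmul (root_refl (wact_root w r)) w.
Proof.
case: r => [[a b] k]; rewrite /is_root /= => ab; apply: W_ext => [|j] /=.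
  by rewrite -tpermJ conjgE mulKVg.
have [j' ->] : exists j', j = w.1 j' by exists (w.1^-1 j)%g; rewrite permKV.
rewrite !ffunE /= permK !(inj_eq perm_inj) tpermV.
have [->|ja] := eqVneq j' a; first by rewrite (negPf ab) tpermL /=; ring.
have [->|jb] := eqVneq j' b; first by rewrite tpermR /=; ring.
by rewrite tpermD ?(inj_eq perm_inj) 1?eq_sym //=; ring.
Qed.

Lemma root_refl_simple i : root_refl (simple_root i) = sgen i.
Proof.
rewrite /root_refl /simple_root /sgen; case: ifP => i0 /=; congr pair; first by rewrite tpermC.
  by apply/ffunP => j; rewrite !ffunE -!val_eqE /=; ring.
by apply/ffunP => j; rewrite !ffunE oppr0 mul0r.
Qed.

Definition root_eval r xi : F := xi.1 r.1.1 - xi.1 r.1.2.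

Lemma root_eval_wact w r xi : root_eval (wact_root w r) (wact_t w xi) = root_eval r xi.
Proof. by rewrite /root_eval /= !ffunE !permK. Qed.

Lemma root_eval_simple i xi : root_eval (simple_root i) xi = alpha_of i xi.
Proof. by rewrite /root_eval /simple_root /alpha_of; case: ifP. Qed.

Lemma root_eval_tbasis r i : root_eval r (tbasis F i) = (i == r.1.1)%:R - (i == r.1.2)%:R.
Proof. by rewrite /root_eval !ffunE ![_ == i]eq_sym. Qed.

Lemma root_eval_sum r xi : root_eval r xi = \sum_i xi.1 i * root_eval r (tbasis F i).
Proof.
under eq_bigr do rewrite root_eval_tbasis mulrBr ![xi.1 _ * _]mulrC.
by rewrite sumrB !sum_delta.
Qed.

Hypothesis N2 : (2 <= N)%N.

Lemma inversions_winv_sgen i w : pos_root (wact_root (winv w) (simple_root i)) ->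
  perm_eq (inversions (winv (wmul (sgen i) w)))
    (simple_root i :: map (wact_root (sgen i)) (inversions (winv w))).
Proof.
move=> pw; have ir := simple_root_is_root N2 i; have pr := simple_root_pos N2 i.
have sK : involutive (wact_root (sgen i)) by move=> r; rewrite -wact_rootM sgenK // wact_root1.
have mapE r : (r \in map (wact_root (sgen i)) (inversions (winv w))) =
    (wact_root (sgen i) r \in inversions (winv w)).
  by rewrite -{1}(sK r) mem_map //; exact: wact_root_inj.
apply: uniq_perm; first exact: inversions_uniq.
  rewrite /= map_inj_uniq ?inversions_uniq ?andbT ?mapE; last exact: wact_root_inj.
  by rewrite mem_inversions wact_simple_root // pos_root_opp // pr andbF.
move=> r; rewrite inE mapE !mem_inversions winvM winv_sgen // wact_rootM is_root_wact.
have [->|ne] := eqVneq r (simple_root i).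
  by rewrite ir pr wact_simple_root // wact_root_opp pos_root_opp ?is_root_wact // pw.
have [->|ne'] := eqVneq (wact_root (sgen i) r) (simple_root i); first by rewrite pw !andbF.
case irr: (is_root r) => //=; congr (_ && _); apply/idP/idP => h; first exact: pos_root_sgen.
by rewrite -[r]sK; apply: pos_root_sgen; rewrite ?is_root_wact.
Qed.

Lemma inversions_winv_pow k w : perm_eq (inversions (winv (wmul (wpowz piW k) w)))
  (map (wact_root (wpowz piW k)) (inversions (winv w))).
Proof.
apply: uniq_perm; rewrite ?map_inj_uniq ?inversions_uniq //; first exact: wact_root_inj.
move=> r; rewrite -{2}(wact_rootVK (wpowz piW k) r) mem_map; last exact: wact_root_inj.
rewrite !mem_inversions winvM wact_rootM is_root_wact; case ir: (is_root r) => //=.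
by rewrite -(pos_root_pow N2 k (r := wact_root _ r)) ?is_root_wact // wact_rootVK.
Qed.

Lemma inversions_pow_nil k : inversions (winv (wpowz piW k) : W N) = [::].
Proof.
have /perm_size := inversions_winv_pow k wone; rewrite wmulw1 size_map winv1 => sz.
apply: size0nil; rewrite sz; case E: (inversions _) => [//|r s].
by have := mem_head r s; rewrite -E mem_inversions wact_root1 => /and3P[_ ->].
Qed.

End Reflections.

Section DunklModel.
Variables (F : numClosedFieldType) (N : nat).
Hypothesis N2 : (2 <= N)%N.
Variable z : tdual F N.
Variable U : free_module F (W N).
Implicit Types (w x y : W N) (r : affine_root N) (xi eta : tvec F N) (p : U).

Local Notation e := (@free_basis F (W N) U).

Definition translate x : {linear U -> U} := free_lift U (fun w => e (wmul x w)).

Definition dunkl_basis xi w : U := dual_pair (wact_dual w z) xi *: e w -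
  \sum_(r <- inversions (winv w)) root_eval r xi *: e (wmul (root_refl r) w).

Definition dunkl xi : {linear U -> U} := free_lift U (dunkl_basis xi).

Definition dunkl_ops : Hops F N U :=
  HOps translate (fun i => dunkl (tbasis F i)) (fun p => z.2 *: p).

Lemma translateU x w : translate x (e w) = e (wmul x w).
Proof. exact: free_liftE. Qed.

Lemma dunklU xi w : dunkl xi (e w) = dunkl_basis xi w.
Proof. exact: free_liftE. Qed.

Lemma dunkl_basis_sum xi w : dunkl_basis xi w =
  \sum_i xi.1 i *: dunkl_basis (tbasis F i) w + (xi.2 * z.2) *: e w.
Proof.
rewrite /dunkl_basis /dual_pair scalerDl scaler_suml addrAC; congr (_ + _).
under [in RHS]eq_bigr do rewrite -/(dual_pair _ _) dual_pair_tbasis scalerBr scalerA scaler_sumr.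
rewrite sumrB; congr (_ - _); rewrite exchange_big /=; apply: eq_bigr => r _.
by rewrite root_eval_sum scaler_suml; apply: eq_bigr => i _; rewrite scalerA.
Qed.

Lemma actT_dunkl_ops xi p : actT dunkl_ops xi p = dunkl xi p.
Proof.
have lact : lin (actT dunkl_ops xi).
  by apply: actT_lin => [i|] a u v; rewrite /= ?linearP // scalerDr !scalerA mulrC.
apply: (free_ext (f := lin_fun lact)) => w; rewrite /= dunklU dunkl_basis_sum /actT /= scalerA.
by under eq_bigr do rewrite dunklU.
Qed.

Lemma dunkl_sgen_coroot i xi p :
  dunkl (wact_t (sgen i) xi) p = dunkl xi p - alpha_of i xi *: dunkl (coroot i) p.
Proof. by rewrite -!actT_dunkl_ops actT_wact_sgen. Qed.

Lemma translateM x y p : translate (wmul x y) p = translate x (translate y p).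
Proof.
move: p; apply: (free_ext (g := translate x \o translate y)) => w /=.
by rewrite !translateU wmulA.
Qed.

Lemma translate1 p : translate wone p = p.
Proof. by move: p; apply: (free_ext (g := idfun)) => w /=; rewrite translateU wmul1w. Qed.

Lemma translate_dunkl_basis x xi w : translate x (dunkl_basis xi w) =
  dual_pair (wact_dual w z) xi *: e (wmul x w) - \sum_(r <- inversions (winv w))
     root_eval r xi *: e (wmul (root_refl (wact_root x r)) (wmul x w)).
Proof.
rewrite /dunkl_basis linearB linearZ /= translateU.
rewrite [translate x (\sum_(r <- _) _)]linear_sum /=; congr (_ - _).
rewrite big_seq [RHS]big_seq; apply: eq_bigr => r; rewrite mem_inversions => /andP[ir _].
by rewrite linearZ /= translateU !wmulA root_refl_conj.
Qed.

Lemma dunkl_basis_sgen i xi w : pos_root (wact_root (winv w) (simple_root i)) ->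
  translate (sgen i) (dunkl_basis xi w) - dunkl_basis (wact_t (sgen i) xi) (wmul (sgen i) w) =
    - alpha_of i xi *: e w.
Proof.
move=> pw; rewrite translate_dunkl_basis /dunkl_basis wact_dualM dual_pair_wact.
rewrite (perm_big _ (inversions_winv_sgen N2 pw)) /= big_cons big_map.
rewrite root_eval_simple alpha_of_sgen root_refl_simple wmulsK //.
under [in X in _ - (_ - X)]eq_bigr do rewrite root_eval_wact.
by apply/eqP; rewrite subr_eq opprD addrCA addNKr.
Qed.

Lemma translate_dunkl_sgen i xi p :
  translate (sgen i) (dunkl xi p) - dunkl (wact_t (sgen i) xi) (translate (sgen i) p) =
    - alpha_of i xi *: p.
Proof.
move: p; apply: (free_ext (f := (translate (sgen i) \o dunkl xi) \-
  (dunkl (wact_t (sgen i) xi) \o translate (sgen i))) (g := - alpha_of i xi \*: idfun)) => w /=.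
rewrite translateU !dunklU.
have [pw|nw] := boolP (pos_root (wact_root (winv w) (simple_root i))).
  exact: dunkl_basis_sgen.
have pw : pos_root (wact_root (winv (wmul (sgen i) w)) (simple_root i)).
  by rewrite wact_rootV_sgen // pos_root_opp // is_root_wact simple_root_is_root.
have := congr1 (translate (sgen i)) (dunkl_basis_sgen (wact_t (sgen i) xi) pw).
rewrite linearB linearZ /= -translateM sgenK // translate1 translateU wmulsK //.
rewrite -wact_tM sgenK // wact_t1 alpha_of_sgen opprK => h.
by rewrite -opprB h scaleNr.
Qed.

Lemma translate_dunkl_pow k xi p : translate (wpowz piW k) (dunkl xi p) =
  dunkl (wact_t (wpowz piW k) xi) (translate (wpowz piW k) p).
Proof.
set c := wpowz _ _; move: p; apply: (free_ext (f := translate c \o dunkl xi)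
  (g := dunkl (wact_t c xi) \o translate c)) => w /=.
rewrite translateU !dunklU translate_dunkl_basis /dunkl_basis wact_dualM dual_pair_wact.
congr (_ - _); rewrite (perm_big _ (inversions_winv_pow N2 k w)) /= big_map.
by apply: eq_bigr => r _; rewrite root_eval_wact.
Qed.

Lemma dunkl_translate_sgen i xi p : dunkl xi (translate (sgen i) p) =
  translate (sgen i) (dunkl (wact_t (sgen i) xi) p) - alpha_of i xi *: p.
Proof.
have := translate_dunkl_sgen i (wact_t (sgen i) xi) p.
rewrite -wact_tM sgenK // wact_t1 alpha_of_sgen opprK => <-.
by rewrite opprB addrC subrK.
Qed.

Lemma dunkl_comm xi eta p : dunkl xi (dunkl eta p) = dunkl eta (dunkl xi p).
Proof.
move: p; apply: (free_ext (f := dunkl xi \o dunkl eta) (g := dunkl eta \o dunkl xi)) => w /=.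
have sw : in_weyl true w by []; move: w sw xi eta.
apply: (weyl_ind N2) => [k _ xi eta|i w _ _ _ IH xi eta].
  have weight (x : tvec F N) : dunkl x (e (wpowz piW k)) =
      dual_pair (wact_dual (wpowz piW k) z) x *: e (wpowz piW k).
    by rewrite dunklU /dunkl_basis inversions_pow_nil // big_nil subr0.
  by rewrite !weight !linearZ /= !weight !scalerA mulrC.
rewrite -translateU; set v := e w.
have expand (x y : tvec F N) : dunkl x (dunkl y (translate (sgen i) v)) =
    translate (sgen i) (dunkl (wact_t (sgen i) x) (dunkl (wact_t (sgen i) y) v))
     + (alpha_of i x * alpha_of i y) *: dunkl (coroot i) v
     - (alpha_of i x *: dunkl y v + alpha_of i y *: dunkl x v).
  rewrite dunkl_translate_sgen linearB linearZ /= dunkl_translate_sgen.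
  rewrite [in alpha_of i x *: _]dunkl_sgen_coroot scalerBr scalerA.
  by rewrite [in RHS]opprD [in RHS]addrA opprB addrA.
by rewrite !expand IH mulrC [X in _ - X]addrC.
Qed.

Lemma dunkl_ops_Hmod : is_Hmod dunkl_ops.
Proof.
split; first by split; [|split] => [x|i|] a p q; rewrite ?linearP //= scalerDr !scalerA mulrC.
- by split; [exact: translate1|exact: translateM].
- by split=> [i j v|i v] /=; [exact: dunkl_comm|rewrite linearZ].
- by move=> i xi v; rewrite !actT_dunkl_ops translate_dunkl_sgen.
- move=> xi v; rewrite !actT_dunkl_ops; have := translate_dunkl_pow 1 xi v.
  by rewrite /wpowz /= wmulw1.
Qed.

End DunklModel.

Section BlockPermutations.
Variables (N : nat) (sel : 'I_N -> bool).
Implicit Types (a b i j : 'I_N) (u : 'S_N).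
Local Notation cuts := (cuts sel).

Definition block_perm u := [forall j, cuts (u j) == cuts j].

Lemma block_permP u : reflect (forall j, cuts (u j) = cuts j) (block_perm u).
Proof. exact: 'forall_eqP. Qed.

Lemma block_permV u j : block_perm u -> cuts ((u^-1)%g j) = cuts j.
Proof. by move=> /block_permP/(_ ((u^-1)%g j)); rewrite permKV. Qed.

Lemma block_perm_mul_tperm u a b : cuts a = cuts b ->
  block_perm (u * tperm a b)%g = block_perm u.
Proof.
move=> ab; apply: eq_forallb => j; rewrite permM.
by case: (tpermP a b (u j)) => [->|->|]; rewrite ?ab.
Qed.

Definition inverts u (q : 'I_N * 'I_N) := (q.1 < q.2)%N && ((u^-1)%g q.2 < (u^-1)%g q.1)%N.

Lemma block_perm_inversion u q : block_perm u -> inverts u q -> cuts q.1 = cuts q.2.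
Proof.
move=> bu /andP[lt inv]; apply/eqP; rewrite eqn_leq cuts_mono ?(ltnW lt) //=.
by rewrite -(block_permV q.1 bu) -(block_permV q.2 bu) cuts_mono // ltnW.
Qed.

Lemma inversions_finite u : perm_eq (inversions (winv (u, [ffun => 0])))
  [seq (q.1, q.2, 0) | q <- enum [pred q | inverts u q]].
Proof.
apply: uniq_perm; first exact: inversions_uniq.
  by rewrite map_inj_uniq ?enum_uniq // => -[a b] [c d] /= [-> ->].
case=> [[a b] k]; rewrite mem_inversions wact_rootVE /= !ffunE addr0 subr0.
apply/idP/mapP => [|[[c d]]]; last first.
  rewrite mem_enum inE /inverts /is_root /pos_root /rootpos /= => h [-> -> ->].
  by move: h; rewrite -val_eqE /=; lia.
rewrite /is_root /pos_root /rootpos /= => /and3P[ab].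
have : (u^-1)%g a != (u^-1)%g b by rewrite (inj_eq perm_inj).
rewrite -!val_eqE /= in ab * => ab' pr nr.
have [k0 inv] : k = 0 /\ inverts u (a, b) by rewrite /inverts /=; lia.
by exists (a, b); rewrite ?mem_enum ?k0.
Qed.

Lemma block_perm_inverts_tperm u (q : 'I_N * 'I_N) :
  block_perm (u * tperm q.1 q.2)%g && inverts (u * tperm q.1 q.2)%g q =
  block_perm u && [&& (q.1 < q.2)%N, cuts q.1 == cuts q.2 & ((u^-1)%g q.1 < (u^-1)%g q.2)%N].
Proof.
have e1 : ((u * tperm q.1 q.2)^-1)%g q.1 = (u^-1)%g q.2 by rewrite invMg tpermV permM tpermL.
have e2 : ((u * tperm q.1 q.2)^-1)%g q.2 = (u^-1)%g q.1 by rewrite invMg tpermV permM tpermR.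
have [cq|nq] := eqVneq (cuts q.1) (cuts q.2).
  by rewrite block_perm_mul_tperm // /inverts e1 e2.
by rewrite !andbF; apply: contraNF nq => /andP[bu /(block_perm_inversion bu)->].
Qed.

End BlockPermutations.

Section BlockSymmetrizer.
Variables (F : numClosedFieldType) (N : nat) (sel : 'I_N -> bool) (z : tdual F N).
Hypothesis zblock : in_tdual_gamma sel z.
Implicit Types (a b i j : 'I_N) (u : 'S_N).
Local Notation cuts := (cuts sel).

Definition block_after j : F := \sum_(b < N) ((j < b)%N && (cuts j == cuts b))%:R.
Definition block_before j : F := \sum_(a < N) ((a < j)%N && (cuts a == cuts j))%:R.

(* [z] with each of its arithmetic progressions along a block reversed. *)
Definition reversed_weight : tdual F N :=
  ([ffun j => z.1 j + block_after j - block_before j], z.2).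

Lemma block_after_prev i : val i != 0%N -> sel i -> block_after (prevo i) = block_after i + 1.
Proof.
move=> i0 si; have ci := cuts_prev_sel i0 si.
rewrite /block_after (bigD1 i) //= [X in _ = X + 1](bigD1 i) //= ltnn add0r ci eqxx.
have -> : (i.-1 < i)%N by move: i0 => /=; lia.
rewrite addrC; congr (_ + 1); apply: eq_bigr => b bi; congr (nat_of_bool (_ && _))%:R.
by move: bi i0; rewrite -val_eqE /=; lia.
Qed.

Lemma weight_block_after a b : cuts a = cuts b -> z.1 a + block_after a = z.1 b + block_after b.
Proof.
wlog ab : a b / (a < b)%N => [h cab|/eqP].
  by case: (ltngtP a b) => [/h|/h h'|/val_inj->] //; [exact|rewrite h'].
rewrite -sameblkE; apply: (sameblk_homo (R := eq) (f := fun j => z.1 j + block_after j)) ab.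
  by move=> p q r -> ->.
by move=> i i0 si; rewrite block_after_prev // (canRL (subrK _) (zblock i0 si)); ring.
Qed.

Definition coord_diff i (q : 'I_N * 'I_N) : F := (i == q.1)%:R - (i == q.2)%:R.

Lemma sum_coord_diff i (C : rel 'I_N) :
  \sum_(q | C q.1 q.2) coord_diff i q = \sum_b (C i b)%:R - \sum_a (C a i)%:R.
Proof.
rewrite big_mkcond -(pair_bigA _ (fun a b => if C a b then coord_diff i (a, b) else 0)) /=.
rewrite -(sum_delta i (fun a => \sum_b (C a b)%:R)).
rewrite -[X in _ - X](_ : \sum_a \sum_b (b == i)%:R * (C a b)%:R = _); last first.
  by apply: eq_bigr => a _; rewrite sum_delta.
rewrite -sumrB; apply: eq_bigr => a _; rewrite mulr_sumr -sumrB; apply: eq_bigr => b _.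
by rewrite /coord_diff -mulrBl ![_ == i]eq_sym; case: (C a b); rewrite ?mulr1 ?mulr0.
Qed.

Lemma sum_coord_diff_noninverted i u : block_perm sel u ->
  \sum_(q : 'I_N * 'I_N | [&& (q.1 < q.2)%N, cuts q.1 == cuts q.2
                           & ((u^-1)%g q.1 < (u^-1)%g q.2)%N]) coord_diff i q =
  block_after i - block_before ((u^-1)%g i).
Proof.
move=> bu.
rewrite (sum_coord_diff i (fun a b => [&& (a < b)%N, cuts a == cuts b
                                       & ((u^-1)%g a < (u^-1)%g b)%N])).
rewrite /block_after /block_before [X in _ = _ - X](reindex_inj (@perm_inj _ (u^-1)%g)) -!sumrB.
apply: eq_bigr => a _; rewrite !(block_permV _ bu) [cuts i == _]eq_sym.
case: (cuts a == cuts i); rewrite ?andbF //= ?andbT.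
have ne : (a == i) = ((u^-1)%g a == (u^-1)%g i) by rewrite (inj_eq perm_inj).
move: ne; rewrite -!val_eqE /=.
by case: (ltngtP a i); case: (ltngtP ((u^-1)%g a) ((u^-1)%g i)) => //=;
  rewrite ?subrr ?subr0 ?sub0r.
Qed.

Variable U : free_module F (W N).
Local Notation e := (@free_basis F (W N) U).
Local Notation M := (dunkl_ops reversed_weight U).

Definition block_symmetrizer : U := \sum_(u | block_perm sel u) e (u, [ffun => 0]).

Lemma dunkl_finite i u : dunkl reversed_weight U (tbasis F i) (e (u, [ffun => 0])) =
  reversed_weight.1 ((u^-1)%g i) *: e (u, [ffun => 0]) -
  \sum_(q | inverts u q) coord_diff i q *: e ((u * tperm q.1 q.2)%g, [ffun => 0]).
Proof.
rewrite dunklU /dunkl_basis dual_pair_tbasis; congr (_ *: _ - _).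
  by rewrite ffunE [X in _ * X%:~R]ffunE mulr0 addr0.
rewrite (perm_big _ (inversions_finite u)) /= big_map big_enum /=; apply: eq_bigr => q _.
rewrite root_eval_tbasis; congr (_ *: e _).
by apply: W_ext => [|j] //=; rewrite !ffunE oppr0 mul0r addr0.
Qed.

(* Multiplication by the transposition of [q] exchanges the block permutations that invert [q]
   with those that do not. *)
Lemma dunkl_block_symmetrizer i :
  dunkl reversed_weight U (tbasis F i) block_symmetrizer = z.1 i *: block_symmetrizer.
Proof.
rewrite /block_symmetrizer linear_sum scaler_sumr; under eq_bigr do rewrite dunkl_finite.
rewrite sumrB (exchange_big_dep xpredT) //=.
have -> : \sum_(q : 'I_N * 'I_N) \sum_(u | block_perm sel u && inverts u q)
     coord_diff i q *: e ((u * tperm q.1 q.2)%g, [ffun => 0]) =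
   \sum_(u | block_perm sel u) (block_after i - block_before ((u^-1)%g i)) *: e (u, [ffun => 0]).
  transitivity (\sum_(q : 'I_N * 'I_N) \sum_(u | block_perm sel u && [&& (q.1 < q.2)%N,
      cuts q.1 == cuts q.2 & ((u^-1)%g q.1 < (u^-1)%g q.2)%N])
      coord_diff i q *: e (u, [ffun => 0])).
    apply: eq_bigr => q _; rewrite (reindex_inj (mulIg (tperm q.1 q.2))) /=.
    apply: eq_big => [u|u _]; first exact: block_perm_inverts_tperm.
    by rewrite -mulgA tperm2 mulg1.
  rewrite (exchange_big_dep (fun u => block_perm sel u)) /=; last by move=> ? ? _ /andP[].
  apply: eq_bigr => u bu; rewrite -sum_coord_diff_noninverted // scaler_suml.
  by apply: eq_bigl => q; rewrite bu.
rewrite -sumrB; apply: eq_bigr => u bu; rewrite -scalerBl; congr (_ *: _).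
by rewrite ffunE (weight_block_after (block_permV i bu)); ring.
Qed.

Lemma block_symmetrizer_rel : relH sel z M block_symmetrizer.
Proof.
split=> [w|i|] //; last exact: dunkl_block_symmetrizer.
move=> [js [sjs ->]]; elim: js sjs => [|i js IH] /=; first by rewrite translate1.
move=> /andP[/andP[i0 si] /IH /= h]; rewrite translateM h.
have ci := cuts_prev_sel i0 si.
rewrite /block_symmetrizer linear_sum [RHS](reindex_inj (mulIg (tperm (prevo i) i))) /=.
apply: eq_big => [u|u _]; first by rewrite block_perm_mul_tperm.
rewrite translateU /sgen (negPf i0); congr e.
by apply: W_ext => [|j] //=; rewrite !ffunE addr0.
Qed.

Lemma block_symmetrizer_neq0 : block_symmetrizer <> 0.
Proof.
pose f := free_lift U (fun w => (w == wone)%:R : F^o).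
move/(congr1 f); rewrite linear0 /block_symmetrizer linear_sum (bigD1 1%g) /=; last first.
  by apply/block_permP => j; rewrite perm1.
rewrite free_liftE eqxx big1 ?addr0 => [/eqP|u /andP[_ /negPf u1]]; first by rewrite oner_eq0.
by rewrite free_liftE xpair_eqE u1.
Qed.

End BlockSymmetrizer.

Lemma relH_nonzero_model (F : numClosedFieldType) (N : nat) (sel : 'I_N -> bool) (z : tdual F N) :
  (2 <= N)%N -> in_tdual_gamma sel z ->
  exists (U : lmodType F) (M : Hops F N U) (u : U), [/\ is_Hmod M, relH sel z M u & u <> 0].
Proof.
move=> N2 zblock; pose U := malg_free_module F (W N).
exists U, (dunkl_ops (reversed_weight sel z) U), (block_symmetrizer sel U); split.
- exact: dunkl_ops_Hmod.
- exact: block_symmetrizer_rel.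
- exact: block_symmetrizer_neq0.
Qed.

(** * The decomposition *)

Section FiniteModules.
Variables (F : numClosedFieldType) (N : nat).
Implicit Types (u : 'S_N) (w : W N) (i : 'I_N) (V : lmodType F).

Lemma sgen_finite i : val i != 0%N -> sgen i = (tperm (prevo i) i, [ffun => 0]).
Proof. by rewrite /sgen => /negPf ->. Qed.

Lemma wmul_finite u u' : wmul (u, [ffun => 0]) (u', [ffun => 0]) = ((u' * u)%g, [ffun => 0]) :> W N.
Proof. by apply: W_ext => // j; rewrite !ffunE addr0. Qed.

Lemma in_weyl_finite w : in_weyl false w -> w = (w.1, [ffun => 0]).
Proof. by case: w => u eta /= /eqP /= ->. Qed.

Lemma in_Wbar_gamma_finite (sel : 'I_N -> bool) w : in_Wbar_gamma sel w -> in_weyl false w.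
Proof.
move=> [js [sjs ->]]; elim: js sjs => [_|i js IH] /=; first exact: eqxx.
by move=> /andP[/andP[i0 _] /IH h]; apply: (@in_weylM _ false) => //; exact: in_weyl_sgen.
Qed.

Lemma wact_t_finite i (xi : tvec F N) : val i != 0%N ->
  wact_t (sgen i) xi = ([ffun j => xi.1 ((tperm (prevo i) i)^-1%g j)], xi.2).
Proof.
move=> i0; rewrite sgen_finite // /wact_t /=; congr pair.
by rewrite big1 ?subr0 // => j _; rewrite ffunE mul0r.
Qed.

Lemma alpha_of_finite i (xi : tvec F N) : val i != 0%N -> alpha_of i xi = xi.1 (prevo i) - xi.1 i.
Proof. by rewrite /alpha_of => /negPf ->. Qed.

Lemma Hmod_hecke_axioms affine V (M : Hops F N V) : is_Hmod M -> hecke_axioms affine M.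
Proof. by move=> [h1 h2 h3 h4 h5]; split. Qed.

Definition hecke_of_Hmod affine V (M : Hops F N V) (hM : is_Hmod M) : hecke_module N affine V :=
  HeckeModule (Hmod_hecke_axioms affine hM).

Lemma resB_Bmod V (M : hecke_module N false V) : is_Bmod (resB M).
Proof.
have [[lW [lX lC]] [h1 hm] [hxx hxc] hs _] := hecke_moduleP M.
have aE xi v : actTb (resB M) xi v = actT M (xi, 0) v by rewrite /actT scale0r addr0.
split=> //=; first by split=> [v|u u' v]; [exact: h1|rewrite -hm wmul_finite].
move=> i xi v i0; have := hs i (xi, 0) v i0.
by rewrite wact_t_finite // alpha_of_finite // sgen_finite // !aE.
Qed.

Definition central_extension V (c : F) (B : Bops F N V) : Hops F N V :=
  HOps (fun w => bW B w.1) (bX B) (fun v => c *: v).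

Lemma resB_central_extension V c (B : Bops F N V) : resB (central_extension c B) = B.
Proof. by case: B. Qed.

Lemma central_extension_axioms V (c : F) (B : Bops F N V) :
  is_Bmod B -> hecke_axioms false (central_extension c B).
Proof.
move=> [[lW lX] [h1 hm] hxx hs]; have lC : lin (fun v : V => c *: v).
  by move=> a u v; rewrite scalerDr !scalerA mulrC.
split; last by [].
- by split; [move=> w; exact: lW|split].
- by split=> [|x y v] /=; [exact: h1|rewrite hm].
- by split=> // i v; exact: (linearZZ (lin_fun (lX i))).
move=> i xi v i0; have aE xi' v' : actT (central_extension c B) xi' v' =
    actTb B xi'.1 v' + xi'.2 *: (c *: v') by [].
rewrite !aE wact_t_finite // alpha_of_finite // sgen_finite //= -(hs i xi.1 v i0).
set s := tperm _ _; have sD := linearD (lin_fun (lW s)); have sZ := linearZZ (lin_fun (lW s)).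
by rewrite /= in sD sZ; rewrite sD !sZ opprD addrACA subrr addr0.
Qed.

Lemma Bgen_Bsub V (B : Bops F N V) v0 : is_Bsub B (Bgen B v0).
Proof. by split; constructor. Qed.

Lemma Bgen_subspace V (B : Bops F N V) v0 : subspace (Bgen B v0).
Proof. by split; [exact: Bg_zero|exact: Bg_add|exact: Bg_scale]. Qed.

Lemma Bgen_min V (B : Bops F N V) v0 Q : is_Bsub B Q -> Q v0 -> forall v, Bgen B v0 v -> Q v.
Proof.
move=> [Q0 QD QZ QW QX] Qv0 v; elim=> // *; [exact: QD|exact: QZ|exact: QW|exact: QX].
Qed.

Lemma Bgen_image V V' (B : Bops F N V) (B' : Bops F N V') v0 (f : {linear V -> V'}) :
  equivB B B' f -> (forall v, Bgen B v0 v) -> forall v', Bgen B' (f v0) v' <-> exists v, f v = v'.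
Proof.
move=> [fW fX] gen v'; split.
  elim=> [||_ _ _ [v <-] _ [w <-]|a _ _ [v <-]|u _ _ [v <-]|i _ _ [v <-]].
  - by exists v0.
  - by exists 0; rewrite linear0.
  - by exists (v + w); rewrite linearD.
  - by exists (a *: v); rewrite linearZ.
  - by exists (bW B u v); rewrite fW.
  - by exists (bX B i v); rewrite fX.
move=> [v <-]; have [Q0 QD QZ QW QX] := Bgen_Bsub B' (f v0).
apply: (Bgen_min (Q := fun v => Bgen B' (f v0) (f v))) (gen v); last exact: Bg_base.
split=> [|x y|a x|u x|i x]; rewrite ?linear0 ?linearD ?linearZ ?fW ?fX //.
- exact: QD.
- exact: QZ.
- exact: QW.
- exact: QX.
Qed.

End FiniteModules.

Section FiniteCyclicModules.
Variables (F : numClosedFieldType) (N : nat) (sel : 'I_N -> bool) (z : tdual F N).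
Hypotheses (N2 : (2 <= N)%N) (zblock : in_tdual_gamma sel z) (zgen : block_generic false sel z).
Implicit Types V : lmodType F.

Lemma Bsub_stable V (M : hecke_module N false V) Q : is_Bsub (resB M) Q -> stable M Q.
Proof.
move=> [Q0 QD QZ QW QX]; split=> // w v /in_weyl_finite-> Qv; exact: QW.
Qed.

Lemma Bgen_orbit_span V (M : hecke_module N false V) one : relH sel z M one ->
  forall v, Bgen (resB M) one v <-> orbit_span M one v.
Proof.
move=> rel1 v; split.
  apply: Bgen_min; last exact: orbit_span_one.
  have [S0 SD SZ] := orbit_span_subspace M one; split=> // [u x|i x].
    by apply: orbit_span_hW; exact: eqxx.
  exact: (orbit_span_hX N2 rel1).
apply: lspan_ind; first exact: Bgen_subspace.
move=> _ [w /in_weyl_finite -> ->]; exact: (Bg_W (B := resB M)) (Bg_base _ _).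
Qed.

Variables (V : lmodType F) (M : hecke_module N false V) (one : V).
Hypotheses (rel1 : relH sel z M one) (one_neq0 : one <> 0).
Local Notation Y := (Bgen (resB M) one).

Lemma Bgen_cyclic_sub Q q : is_Bsub (resB M) Q -> Y q -> Q q -> q <> 0 -> forall v, Y v -> Q v.
Proof.
move=> sQ /(Bgen_orbit_span rel1) hq Qq q0; apply: Bgen_min => //.
have zc : false -> z.2 != 0 by [].
exact: (stable_contains_one N2 zblock zgen zc rel1 (Bsub_stable sQ) hq Qq q0).
Qed.

Lemma Bgen_irreducible : Birreducible (resB M) Y.
Proof.
split; first by exists one; split; [exact: Bg_base|].
move=> Q sQ QY; have [[q [Qq q0]]|none] := classic (exists q, Q q /\ q <> 0).
  by right; apply: (Bgen_cyclic_sub sQ (QY q Qq) Qq q0).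
by left=> v Qv; apply: NNPP => v0; apply: none; exists v.
Qed.

Lemma relH_central_extension (Vb : lmodType F) (Bb : Bops F N Vb) oneb :
  relB sel z.1 Bb oneb -> relH sel z (central_extension z.2 Bb) oneb.
Proof.
move=> [invW wX]; split=> // w hw; apply: invW.
by rewrite -(in_weyl_finite (in_Wbar_gamma_finite hw)).
Qed.

Lemma induced_map_injective (Vb : lmodType F) (Bb : Bops F N Vb) oneb (f : {linear Vb -> V}) :
  is_induced_B sel z.1 Bb oneb -> equivB Bb (resB M) f -> f oneb = one -> injective f.
Proof.
move=> [hB relb gen _] [fW fX] f1.
pose Mb := HeckeModule (central_extension_axioms z.2 hB).
have relMb : relH sel z Mb oneb := relH_central_extension relb.
have ker_stable : stable Mb (fun v => f v = 0).
  split=> [|i v fv|w v _ fv]; first exact: (subspace_preim f (subspace0 V)).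
    by rewrite /= fX fv; exact: (linear0 (hX M i)).
  by rewrite /= fW fv; exact: (linear0 (hW M (w.1, [ffun => 0]))).
move=> v w fvw; apply/eqP; rewrite -subr_eq0; apply/idPn => /eqP vw0; case: one_neq0; rewrite -f1.
have zc : false -> z.2 != 0 by [].
apply: (stable_contains_one N2 zblock zgen zc relMb ker_stable _ _ vw0).
  by apply/(Bgen_orbit_span relMb); rewrite resB_central_extension.
by rewrite linearB fvw subrr.
Qed.

Lemma Bgen_induced_iso (Vb : lmodType F) (Bb : Bops F N Vb) (oneb : Vb) :
  is_induced_B sel z.1 Bb oneb ->
  exists f : Vb -> V, [/\ lin f, equivB Bb (resB M) f, f oneb = one, injective f
    & forall v, Y v <-> exists q, f q = v].
Proof.
move=> hYb; have [hB relb gen univ] := hYb.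
have [|f [lf fB f1]] := univ V (resB M) one (resB_Bmod M).
  by case: rel1 => invW wX _; split=> // u hu; exact: invW.
exists f; split=> //; first exact: (induced_map_injective (f := lin_fun lf) hYb).
rewrite -f1; exact: (Bgen_image (f := lin_fun lf) fB gen).
Qed.

End FiniteCyclicModules.

Section Decomposition.
Variables (F : numClosedFieldType) (N : nat) (sel : 'I_N -> bool) (z : tdual F N).
Hypotheses (N2 : (2 <= N)%N) (zblock : in_tdual_gamma sel z) (zgen : block_generic true sel z).
Implicit Types (x w : W N) (i : 'I_N).

Lemma min_rep_selB_pair x i : val i != 0%N -> min_rep sel x -> selB sel x i ->
  root_pair (wact_dual x z) (simple_root i) = -1.
Proof.
move=> i0 mx; rewrite selBE // root_pair_wactV => /eqP h0.
have [p [p0 sp] ->] := min_rep_simple_preimage N2 i0 mx h0.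
by rewrite -(zblock p0 sp) /simple_root (negPf p0) /root_pair /pair_root mul0r addr0.
Qed.

Lemma min_rep_in_tdual x : min_rep sel x -> in_tdual_gamma (selB sel x) (wact_dual x z).
Proof.
move=> mx i i0 /(min_rep_selB_pair i0 mx).
by rewrite /simple_root (negPf i0) /root_pair /pair_root mul0r addr0.
Qed.

Lemma dominant_block_generic x : dominant_rep sel x ->
  block_generic false (selB sel x) (wact_dual x z).
Proof.
move=> dx [[a b] k] /eqP/= -> ir hr; rewrite root_pair_wactV.
apply: (root_pair_nonresonant zgen) => //; first by rewrite is_root_wact.
have ab : (a < b)%N.
  by have := pos_root_block_height ir hr; rewrite /pos_root /rootpos /=; lia.
rewrite block_height_winv subr_eq0 eq_sym -sameblk_selB ?(ltnW ab) //.
by rewrite sameblkE; apply: contraTneq hr; rewrite /block_height /= => ->; rewrite subrr mulr0.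
Qed.

Hypothesis zc : z.2 != 0.
Variables (V : lmodType F) (M : Hops F N V) (one : V).
Hypotheses (hM : is_Hmod M) (rel1 : relH sel z M one) (one_neq0 : one <> 0).
Implicit Types v y : V.

Local Notation Maff := (hecke_of_Hmod true hM).
Local Notation Mfin := (hecke_of_Hmod false hM).
Local Notation weight := (orbit_weight z Maff one).

Lemma phi_red_weight x rd : min_rep sel x -> is_red x rd ->
  weight x (phi_red M rd one) /\ phi_red M rd one <> 0.
Proof.
move=> mx xr; have [xE _] := xr.
have [|r rr|_ _ wv v0] := phi_word_weight (js := rd.2) N2 zgen (M := Maff) rel1.
- exact/allP.
- exact: min_rep_inversion mx (word_roots_red N2 xr rr).
split; first by rewrite {1}xE; exact: (orbit_weight_pow (M := Maff)).
rewrite /phi_red -[RHS](linear0 (hW Maff (wpowz piW rd.1))).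
by move=> /(can_inj (hWK Maff _)); exact: v0.
Qed.

Lemma selB_relH x y : min_rep sel x -> weight x y ->
  relH (selB sel x) (wact_dual x z) M y.
Proof.
move=> mx wy; have [[wX wC] _] := wy; split=> // w [js [sjs ->]].
elim: js sjs => [_|i js IH] /=; first exact: (hW1 Maff).
move=> /andP[/andP[i0 si] /IH h]; rewrite (hWM Maff) h.
have : phi_gen M i y = 0.
  apply: (phi_eq0 N2 zblock zgen (fun _ => zc) (M := Maff) rel1 (w := x)) => //.
  by apply/eqP; rewrite -selBE.
rewrite (phi_weight (M := Maff) i wy.1) min_rep_selB_pair // scaleN1r => /eqP.
by rewrite subr_eq0 => /eqP.
Qed.

Lemma dominant_Bgen_irreducible x y : dominant_rep sel x -> weight x y -> y <> 0 ->
  Birreducible (resB M) (Bgen (resB M) y).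
Proof.
move=> dx wy; have mx := dominant_rep_min dx.
have rely := selB_relH mx wy; have zx := min_rep_in_tdual mx.
exact: (Bgen_irreducible N2 zx (dominant_block_generic dx) (M := Mfin) rely).
Qed.

Lemma dominant_Bgen_induced_iso x y (Vb : lmodType F) (Bb : Bops F N Vb) (oneb : Vb) :
  dominant_rep sel x -> weight x y -> y <> 0 ->
  is_induced_B (selB sel x) (wact_dual x z).1 Bb oneb ->
  exists f : Vb -> V, [/\ lin f, equivB Bb (resB M) f, f oneb = y, injective f
    & forall v, Bgen (resB M) y v <-> exists q, f q = v].
Proof.
move=> dx wy y0; have mx := dominant_rep_min dx.
have rely := selB_relH mx wy; have zx := min_rep_in_tdual mx.
exact: (Bgen_induced_iso N2 zx (dominant_block_generic dx) (M := Mfin) rely y0).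
Qed.

(* An intertwiner that raises the length inside the [S_N]-orbit is invertible, so it neither
   leaves nor enters an \bar H-submodule. *)
Lemma weight_in_dominant_Bgen (phi : W N -> V) :
  (forall x, dominant_rep sel x -> weight x (phi x) /\ phi x <> 0) ->
  forall w, min_rep sel w -> forall v, weight w v ->
  exists2 x, dominant_rep sel x & Bgen (resB M) (phi x) v.
Proof.
move=> hphi; apply: (dominant_rep_ind N2) => [x dx v wv|i w i0 mw h IH v wv].
  have [wx x0] := hphi x dx; exists x => //.
  have [//|c ->] := orbit_weight_line N2 zblock zgen (fun _ => zc) (M := Maff) rel1 _ wx wv x0.
  exact: Bg_scale (Bg_base _ _).
have [x dx Bx] := IH _ (orbit_weight_phi N2 (M := Maff) rel1 isT wv); exists x => //.
have [||c c0 e] := phi_phi_min_rep N2 zgen (M := Maff) (i := i) isT _ mw _ wv; rewrite ?gt_eqF //.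
apply: (subspace_unscale (Bgen_subspace _ _) c0); rewrite -e.
have stB := Bsub_stable (M := Mfin) (Bgen_Bsub (resB M) (phi x)).
exact: (stable_phi stB i0 (weight_vec_phi N2 (M := Maff) (i := i) isT wv.1) Bx).
Qed.

Lemma orbit_span_dominant_sum (phi : W N -> V) :
  (forall x, dominant_rep sel x -> weight x (phi x) /\ phi x <> 0) ->
  forall v, orbit_span Maff one v -> exists (s : seq (W N)) (m : W N -> V),
    [/\ forall x, x \in s -> dominant_rep sel x, forall x, Bgen (resB M) (phi x) (m x)
      & v = \sum_(x <- s) m x].
Proof.
move=> hphi v hv; apply: (lspan_family (Q := fun x => Bgen (resB M) (phi x))) => [x|].
  exact: Bgen_subspace.
apply: lspan_ind (orbit_span_weights N2 zblock zgen (M := Maff) rel1 hv) => [|u [w sw wu]].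
  exact: lspan_subspace.
have [->|/eqP u0] := eqVneq u 0; first exact: lspan0.
have mw := orbit_weight_min_rep N2 zblock zgen (fun _ => zc) (M := Maff) rel1 sw wu u0.
by apply: mem_lspan; exact: (weight_in_dominant_Bgen hphi mw wu).
Qed.

Definition finite_orbit_weights x (z' : tdual F N) :=
  exists2 w, in_weyl false w & z' = wact_dual w (wact_dual x z).

Lemma Bgen_weight_span x y v : dominant_rep sel x -> weight x y ->
  Bgen (resB M) y v -> weight_span Maff (finite_orbit_weights x) v.
Proof.
move=> dx wy; have mx := dominant_rep_min dx; have rely := selB_relH mx wy.
move=> /(Bgen_orbit_span N2 (M := Mfin) rely) hv.
have := orbit_span_weights N2 (min_rep_in_tdual mx) (dominant_block_generic dx) (M := Mfin) rely hv.
apply: lspan_ind => [|u [w sw [wu _]]]; first exact: lspan_subspace.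
by apply: mem_lspan; exists (wact_dual w (wact_dual x z)) => //; exists w.
Qed.

Lemma finite_orbit_weights_disjoint x x' z1 z2 : dominant_rep sel x -> dominant_rep sel x' ->
  finite_orbit_weights x z1 -> finite_orbit_weights x' z2 -> z1.1 = z2.1 -> x = x'.
Proof.
move=> dx dx' [w sw ->] [w' sw' ->]; rewrite -!wact_dualM => e.
have {}e := wact_dual_inj zblock zgen (fun _ => zc) isT isT e.
have xE : x = wmul (wmul (winv w) w') x' by rewrite -wmulA -e wmulKw.
have /in_weyl_finite sE : in_weyl false (wmul (winv w) w').
  by apply: (@in_weylM _ false) => //; exact: (@in_weylV _ false).
by apply: (dominant_rep_uniq N2 dx dx' (u := (wmul (winv w) w').1)); rewrite -sE.
Qed.

Lemma dominant_sum_independent (phi : W N -> V) (s : seq (W N)) (m : W N -> V) :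
  (forall x, dominant_rep sel x -> weight x (phi x)) ->
  uniq s -> (forall x, x \in s -> dominant_rep sel x) ->
  (forall x, x \in s -> Bgen (resB M) (phi x) (m x)) ->
  \sum_(x <- s) m x = 0 -> forall x, x \in s -> m x = 0.
Proof.
move=> hphi us ds ms s0 x xs.
have span x' : x' \in s -> weight_span Maff (finite_orbit_weights x') (m x').
  by move=> xs'; apply: Bgen_weight_span (ms x' xs'); [exact: ds|apply/hphi/ds].
pose others z' := exists x', [/\ x' \in s, x' != x & finite_orbit_weights x' z'].
apply: (weight_span_disjoint (M := Maff) (c := z.2) (Z' := others) _ _ (span x xs)).
- by move=> _ [w _ ->].
- move=> z1 z2 xz1 [x' [xs' xx' xz2]] e; case/eqP: xx'.
  exact: finite_orbit_weights_disjoint (ds x' xs') (ds x xs) xz2 xz1 e.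
have -> : m x = \sum_(x' <- s | x' != x) - m x'.
  by apply/eqP; rewrite sumrN -addr_eq0 -(bigD1_seq x) //= s0.
rewrite -big_filter; apply: subspace_sum => [|x']; first exact: lspan_subspace.
rewrite mem_filter => /andP[xx' xs']; rewrite -scaleN1r.
have [_ _ SZ] := lspan_subspace (fun u => exists2 z', others z' & weight_vec M z' u).
apply: SZ; apply: lspan_ind (span x' xs') => [|u [z' yz' wu]]; first exact: lspan_subspace.
by apply: mem_lspan; exists z' => //; exists x'.
Qed.

End Decomposition.

Section InducedModules.
Variables (F : numClosedFieldType) (N : nat) (sel : 'I_N -> bool) (z : tdual F N).
Hypotheses (N2 : (2 <= N)%N) (zblock : in_tdual_gamma sel z).
Variables (V : lmodType F) (M : Hops F N V) (one : V).

Lemma induced_one_neq0 : is_induced_H sel z M one -> one <> 0.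
Proof.
move=> [_ _ _ univ] one_neq0.
have [U [MU [u [hU relu u0]]]] := relH_nonzero_model N2 zblock.
have [f [lf _ f1]] := univ U MU u hU relu.
by apply: u0; rewrite -f1 one_neq0; exact: (linear0 (lin_fun lf)).
Qed.

Lemma generic_block_generic : generic sel z -> block_generic true sel z.
Proof.
move=> zgen [[a b] k] _ ir; rewrite block_height_gt0 // => /andP[pr nr].
by apply/and3P; split; apply/eqP => e; apply: (zgen a b k ir pr nr);
  [left|right; left|right; right].
Qed.

Hypotheses (hM : is_Hmod M) (rel1 : relH sel z M one) (zgen : block_generic true sel z).

Local Notation Maff := (hecke_of_Hmod true hM).

Lemma Hgen_orbit_span v : Hgen M one v -> orbit_span Maff one v.
Proof.
have [S0 SD SZ] := orbit_span_subspace Maff one.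
elim=> {v} [||u v _ hu _ hv|a u _ hu|w u _ hu|i u _ hu|u _ hu].
- exact: orbit_span_one.
- exact: S0.
- exact: SD.
- exact: SZ.
- exact: (orbit_span_hW (M := Maff)).
- exact: (orbit_span_hX N2 (M := Maff) rel1).
- by rewrite (orbit_span_hC N2 zblock zgen (M := Maff) rel1 hu); exact: SZ.
Qed.

End InducedModules.

Theorem theorem2p23 (F : numClosedFieldType) (N : nat) (hN : (2 <= N)%N)
  (beta : seq nat) (hbeta : is_composition N beta)
  (zeta : tdual F N)
  (hzeta : in_tdual_gamma (selP beta) zeta)
  (hgen : generic (selP beta) zeta)
  (hc : zeta.2 != 0)
  (V : lmodType F) (M : Hops F N V) (one : V)
  (hY : is_induced_H (selP beta) zeta M one)
  (red : W N -> int * seq 'I_N)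
  (hred : forall x, in_X (selP beta) x -> is_red x (red x)) :
  let B := resB M in
  let phi1 := fun x => phi_red M (red x) one in
  let Mx := fun x => Bgen B (phi1 x) in
  (* Y_beta(zeta) = direct sum of the Hbar . phi_x 1_zeta, x in X^beta *)
  (forall v : V, exists (s : seq (W N)) (m : W N -> V),
      [/\ forall x, x \in s -> in_X (selP beta) x,
          forall x, x \in s -> Mx x (m x)
        & v = \sum_(x <- s) m x]) /\
  (forall (s : seq (W N)) (m : W N -> V),
      uniq s -> (forall x, x \in s -> in_X (selP beta) x) ->
      (forall x, x \in s -> Mx x (m x)) ->
      \sum_(x <- s) m x = 0 -> forall x, x \in s -> m x = 0) /\
  (* each summand is irreducible *)
  (forall x, in_X (selP beta) x -> Birreducible B (Mx x)) /\
  (* and isomorphic to \bar Y_{beta(x)}(\bar{x(zeta)}) via 1 |-> phi_x 1_zeta *)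
  (forall x, in_X (selP beta) x ->
     forall (Vb : lmodType F) (Bb : Bops F N Vb) (oneb : Vb),
       is_induced_B (selB (selP beta) x) (wact_dual x zeta).1 Bb oneb ->
       exists f : Vb -> V,
         [/\ lin f, equivB Bb B f, f oneb = phi1 x, injective f
           & forall v, Mx x v <-> exists w, f w = v]).
Proof.
have [hM rel1 gen _] := hY; have zgen := generic_block_generic hgen.
have one_neq0 := induced_one_neq0 hN hzeta hY.
have XP x : in_X (selP beta) x <-> dominant_rep (selP beta) x := in_XP (selP beta) hN x.
have phiP x : dominant_rep (selP beta) x ->
    orbit_weight zeta (hecke_of_Hmod true hM) one x (phi_red M (red x) one) /\
    phi_red M (red x) one <> 0.
  by move=> dx; apply: (phi_red_weight hN zgen) (dominant_rep_min dx) _ => //; apply/hred/XP.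
split=> [v|].
  have hv := Hgen_orbit_span hN hzeta (hM := hM) rel1 zgen (gen v).
  have [s [m [ds ms ->]]] := orbit_span_dominant_sum hN hzeta zgen hc rel1 phiP hv.
  by exists s, m; split=> // x /ds/XP.
split=> [s m us Xs|].
  apply: (dominant_sum_independent hN hzeta zgen hc (hM := hM) rel1) us _ => [x|x /Xs/XP //].
  by case/phiP.
split=> x /XP dx; have [wx x0] := phiP x dx.
  exact: (dominant_Bgen_irreducible hN hzeta zgen hc rel1 dx wx x0).
by move=> Vb Bb oneb; exact: (dominant_Bgen_induced_iso hN hzeta zgen hc rel1 dx wx x0).
Qed.
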